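(* Let $\Lambda$ be an $n$-bounded partially ordered set (for some $n\in\mathbb{N}$) and let $P$ be a commutative, profinite, second countable ring. If $G$ is a totally disconnected, locally compact, second countable group having $\mathrm{GL}_\Lambda(P)$ as an open compact subgroup (i.e. an open compact subgroup of $G$ is topologically isomorphic to $\mathrm{GL}_\Lambda(P)$), then $G$ is an elementary group with $\xi(G)<\omega$.
   Context: A partially ordered set $(\Lambda,\preceq)$ is $n$-bounded if for every $s\in\Lambda$ the set $\mathcal{N}_1(s)=\{t: t\preceq s\text{ or }s\preceq t\}$ has at most $n$ elements; in particular all intervals $[s_1,s_2]=\{t: s_1\preceq t\preceq s_2\}$ are then finite. Rings have an identity and are nontrivial; topological rings are Hausdorff. The incidence ring is $\mathrm{M}_\Lambda(P)=\{(a_{s_1,s_2})\in P^{\Lambda\times\Lambda}: a_{s_1,s_2}\neq 0\Rightarrow s_1\preceq s_2\}$ with coordinatewise addition and multiplication $(ab)_{s_1,s_2}=\sum_{t\in[s_1,s_2]}a_{s_1,t}b_{t,s_2}$. $\mathrm{GL}_\Lambda(P)$ is its group of units, with the subspace topology from the product topology on $P^{\Lambda\times\Lambda}$. Write t.d.l.c.s.c. for totally disconnected, locally compact, second countable (Hausdorff). The class $\mathcal{E}$ of elementary groups is the smallest class of t.d.l.c.s.c. groups such that: (i) $\mathcal{E}$ contains all second countable profinite groups and all countable discrete groups; (ii) $\mathcal{E}$ is closed under group extensions: if $N\trianglelefteq H$ is a closed normal subgroup of the t.d.l.c.s.c. group $H$ with $N\in\mathcal{E}$ and $H/N\in\mathcal{E}$,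 then $H\in\mathcal{E}$; (iii) $\mathcal{E}$ is closed under closed subgroups; (iv) $\mathcal{E}$ is closed under quotients by closed normal subgroups; (v) if a t.d.l.c.s.c. group $G$ is the union of an increasing sequence $(O_i)_{i\in\mathbb{N}}$ of open subgroups with each $O_i\in\mathcal{E}$, then $G\in\mathcal{E}$. The rank $\xi$ is Wesolek's decomposition rank, the unique ordinal-valued function on $\mathcal{E}$ with $\xi(\{1\})=1$ and, for $G\neq\{1\}$ written as the union of an increasing sequence $(O_i)_{i\in\mathbb{N}}$ of compactly generated open subgroups, $\xi(G)=\sup_i\xi(\mathrm{Res}(O_i))+1$, where $\mathrm{Res}(O)$ is the intersection of all open normal subgroups of $O$. Here $\omega$ is the first infinite ordinal. *)

(* Defs.v *)
From HB Require Import structures.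
From mathcomp Require Import all_boot all_order all_algebra.
From mathcomp Require Import finmap.
From mathcomp Require Import all_classical all_reals all_analysis.

Set Implicit Arguments.
Unset Strict Implicit.
Unset Printing Implicit Defensive.

Import Order.TTheory GRing.Theory.

Local Open Scope classical_set_scope.

#[short(type="preTopGroupType")]
HB.structure Definition PreTopologicalGroup := {G of Group G & Topological G}.

HB.mixin Record PreTopologicalGroup_isTopologicalGroup G
    of PreTopologicalGroup G := {
  mulg_continuous : continuous (fun x : G * G => (x.1 * x.2)%g) ;
  invg_continuous : continuous (fun x : G => x^-1%g)
}.

#[short(type="topGroupType")]
HB.structure Definition TopologicalGroup :=
  {G of PreTopologicalGroup G & PreTopologicalGroup_isTopologicalGroup G}.

HB.mixin Record TopologicalZmodule_isTopologicalRing R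
    of TopologicalZmodule R & GRing.ComNzRing R := {
  mulr_continuous : continuous (fun x : R * R => (x.1 * x.2)%R)
}.

#[short(type="topComNzRingType")]
HB.structure Definition TopologicalComNzRing :=
  {R of TopologicalZmodule R & GRing.ComNzRing R
      & TopologicalZmodule_isTopologicalRing R}.

(* A topological group or ring is profinite when its underlying space is      *)
(* compact, Hausdorff and totally disconnected.                               *)
Definition profinite (T : topologicalType) : Prop :=
  [/\ compact [set: T], hausdorff_space T & totally_disconnected [set: T]].

Definition tdlcsc (T : topologicalType) : Prop :=
  [/\ totally_disconnected [set: T], locally_compact [set: T],
      @second_countable T & hausdorff_space T].

Definition topologically_isomorphic (G H : preTopGroupType) : Prop :=
  exists (f : G -> H) (g : H -> G),
    [/\ {morph f : x y / (x * y)%g}, cancel f g, cancel g f,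
        continuous f & continuous g].

Record subgroup (G : topGroupType) := Subgroup {
  subgroup_set :> set G ;
  subgroup_closed : group_closed (mem subgroup_set)
}.

Definition subgrp (G : topGroupType) (H : subgroup G) : Type := set_type H.

Section SubgroupTopology.
Variables (G : topGroupType) (H : subgroup G).

HB.instance Definition _ := SubChoice.copy (subgrp H) (set_type H).
HB.instance Definition _ := Topological.copy (subgrp H) (set_type H).
HB.instance Definition _ :=
  SubChoice_isSubGroup.Build G (mem (subgroup_set H)) (subgrp H)
    (subgroup_closed H).

Lemma subgrp_val_continuous : continuous (val : subgrp H -> G).
Proof. exact: (@initial_continuous (set_type H) G set_val). Qed.

Lemma subgrp_continuous (T : topologicalType) (f : T -> subgrp H) :
  continuous (val \o f) -> continuous f.
Proof.
move=> /continuousP cf; apply/continuousP => _ [B oB <-].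
by rewrite -comp_preimage; exact: cf.
Qed.

Lemma subgrp_mulg_continuous :
  continuous (fun x : subgrp H * subgrp H => (x.1 * x.2)%g).
Proof.
apply: subgrp_continuous.
rewrite (_ : _ \o _ = (fun y : G * G => (y.1 * y.2)%g) \o
  (fun x : subgrp H * subgrp H => (val x.1, val x.2))); last first.
  by apply/funext => x.
move=> x; apply: continuous_comp; last exact: mulg_continuous.
apply: cvg_pair.
  by apply: (@continuous_comp _ _ _ fst (val : subgrp H -> G));
    [exact: cvg_fst|exact: subgrp_val_continuous].
by apply: (@continuous_comp _ _ _ snd (val : subgrp H -> G));
  [exact: cvg_snd|exact: subgrp_val_continuous].
Qed.

Lemma subgrp_invg_continuous : continuous (fun x : subgrp H => x^-1%g).
Proof.
apply: subgrp_continuous.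
rewrite (_ : _ \o _ = (fun y : G => y^-1%g) \o val); last first.
  by apply/funext => x.
move=> x; apply: continuous_comp; last exact: invg_continuous.
exact: subgrp_val_continuous.
Qed.

HB.instance Definition _ :=
  PreTopologicalGroup_isTopologicalGroup.Build (subgrp H)
    subgrp_mulg_continuous subgrp_invg_continuous.

End SubgroupTopology.

Definition normal (G : topGroupType) (N : set G) : Prop :=
  forall x g : G, N x -> N (x ^ g)%g.

(* [p] exhibits [Q], with the quotient topology, as the quotient group G/N;   *)
(* such a [Q] is determined up to topological isomorphism.                    *)
Definition quotient_map (G Q : topGroupType) (N : set G) (p : G -> Q) : Prop :=
  [/\ {morph p : x y / (x * y)%g},
      range p = [set: Q],
      p @^-1` [set 1%g] = N
    & forall V : set Q, open (p @^-1` V) <-> open V].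

Definition increasing_open_union (G : topGroupType) (O : nat -> subgroup G) :=
  [/\ forall i, open (O i), forall i, O i `<=` O i.+1
    & \bigcup_i O i = [set: G]].

Inductive elementary : topGroupType -> Prop :=
| elementary_profinite (G : topGroupType) :
    profinite G -> @second_countable G -> elementary G
| elementary_discrete (G : topGroupType) :
    countable [set: G] -> (forall x : G, open [set x]) -> elementary G
| elementary_extension (G : topGroupType) (N : subgroup G) (Q : topGroupType)
    (p : G -> Q) :
    tdlcsc G -> closed N -> normal N -> quotient_map N p ->
    elementary (subgrp N) -> elementary Q -> elementary G
| elementary_subgroup (G : topGroupType) (H : subgroup G) :
    elementary G -> closed H -> elementary (subgrp H)
| elementary_quotient (G : topGroupType) (N : subgroup G) (Q : topGroupType)
    (p : G -> Q) :
    elementary G -> closed N -> normal N -> quotient_map N p -> elementary Q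
| elementary_union (G : topGroupType) (O : nat -> subgroup G) :
    tdlcsc G -> increasing_open_union O ->
    (forall i, elementary (subgrp (O i))) -> elementary G.

Definition residual_set (G : topGroupType) : set G :=
  \bigcap_(N in [set N : subgroup G | open N /\ normal N]) N.

Lemma residual_closed (G : topGroupType) : group_closed (mem (@residual_set G)).
Proof.
split=> [|x y].
  by rewrite inE => N _; apply/set_mem; case: (subgroup_closed N).
rewrite !inE => xR yR N hN; apply/set_mem; case: (subgroup_closed N) => _.
by apply; apply/mem_set; [exact: xR|exact: yR].
Qed.

Definition residual (G : topGroupType) : subgroup G :=
  Subgroup (@residual_closed G).

Definition compactly_generated (G : topGroupType) : Prop :=
  exists2 K : set G, compact K &
    forall H : subgroup G, K `<=` H -> [set: G] `<=` H.

(* The ordinals, represented by well-founded trees: [OrdSup f] stands for the *)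
(* least ordinal greater than all the [f i]. Distinct trees may stand for the *)
(* same ordinal, so equality of ordinals is [ord_eq]. Branching over [Set] is *)
(* enough, since ranks are suprema of sequences.                              *)
Inductive Ord : Type := OrdSup (A : Set) (f : A -> Ord).

Fixpoint ord_le (a b : Ord) : Prop :=
  let: OrdSup A f := a in
  let: OrdSup B g := b in
  forall i, exists j, ord_le (f i) (g j).

Definition ord_lt (a b : Ord) : Prop :=
  let: OrdSup B g := b in exists j, ord_le a (g j).

Definition ord_eq (a b : Ord) : Prop := ord_le a b /\ ord_le b a.

Definition ord0 : Ord := OrdSup (fun x : Empty_set => match x with end).

Definition ord_succ (a : Ord) : Ord := OrdSup (fun _ : unit => a).

Definition ord_index (a : Ord) : Set := let: OrdSup A _ := a in A.

Definition ord_branch (a : Ord) : ord_index a -> Ord :=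
  let: OrdSup _ f := a in f.

Definition ord_sup (f : nat -> Ord) : Ord :=
  OrdSup (fun p : {n : nat & ord_index (f n)} => ord_branch (projT2 p)).

Definition ord_nat (n : nat) : Ord := iter n ord_succ ord0.

Definition omega : Ord := OrdSup ord_nat.

(* [has_rank G a] is the graph of xi: it is generated by the two equations    *)
(* that define xi, and is functional by [has_rank_unique] below.              *)
Inductive has_rank : topGroupType -> Ord -> Prop :=
| has_rank_trivial (G : topGroupType) (a : Ord) :
    [set: G] = [set 1%g] -> ord_eq a (ord_nat 1) -> has_rank G a
| has_rank_union (G : topGroupType) (O : nat -> subgroup G)
    (b : nat -> Ord) (a : Ord) :
    [set: G] <> [set 1%g] ->
    increasing_open_union O ->
    (forall i, compactly_generated (subgrp (O i))) ->
    (forall i, has_rank (subgrp (residual (subgrp (O i)))) (b i)) ->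
    ord_eq a (ord_succ (ord_sup b)) ->
    has_rank G a.

Section OrdTheory.

Lemma ord_leE (a b : Ord) : ord_le a b <->
  forall i : ord_index a, exists j : ord_index b,
    ord_le (ord_branch i) (ord_branch j).
Proof. by case: a; case: b. Qed.

Lemma ord_le_refl (a : Ord) : ord_le a a.
Proof. by elim: a => A f IH /= i; exists i. Qed.

Lemma ord_le_trans (b a c : Ord) : ord_le a b -> ord_le b c -> ord_le a c.
Proof.
elim: a b c => A f IH [B g] [C h] /= ab bc i.
have [j fg] := ab i; have [k gh] := bc j.
by exists k; apply: IH fg gh.
Qed.

Lemma ord_le0 (a : Ord) : ord_le ord0 a.
Proof. by case: a => A f []. Qed.

Lemma ord_le_succ (a b : Ord) : ord_le a b -> ord_le (ord_succ a) (ord_succ b).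
Proof. by move=> ab i; exists tt. Qed.

Lemma ord_sup_ge (f : nat -> Ord) (n : nat) : ord_le (f n) (ord_sup f).
Proof.
apply/ord_leE => i; exists (existT _ n i); exact: ord_le_refl.
Qed.

Lemma ord_sup_le (f : nat -> Ord) (b : Ord) :
  (forall n, ord_le (f n) b) -> ord_le (ord_sup f) b.
Proof.
by move=> fb; apply/ord_leE => -[n i]; move: (fb n) => /ord_leE; exact.
Qed.

End OrdTheory.

Lemma morph_group1 (G H : topGroupType) (f : G -> H) :
  {morph f : x y / (x * y)%g} -> f 1%g = 1%g.
Proof.
by move=> fM; apply: (mulgI (f 1%g)); rewrite -fM !mulg1.
Qed.

Lemma preimage_group_closed (G H : topGroupType) (f : G -> H)
    (N : subgroup H) :
  {morph f : x y / (x * y)%g} -> group_closed (mem (f @^-1` N)).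
Proof.
move=> fM; have [N1 ND] := subgroup_closed N.
have f1 := morph_group1 fM.
have fV x : f x^-1%g = (f x)^-1%g.
  by apply: (mulgI (f x)); rewrite -fM !mulgV.
split=> [|x y]; first by rewrite inE /= f1; apply/set_mem.
rewrite !inE /= => Nx Ny; rewrite fM fV; apply/set_mem.
by apply: ND; apply/mem_set.
Qed.

Lemma compactly_generated_sub (G H : topGroupType) (f : H -> G)
    (O : nat -> subgroup G) :
  {morph f : x y / (x * y)%g} -> continuous f ->
  increasing_open_union O -> compactly_generated H ->
  exists m, forall x, (O m : set G) (f x).
Proof.
move=> fM fc [oO O_incr O_cover] [K cK genK].
have O_mono : {homo (fun i => O i : set G) : i j / (i <= j)%N >-> i `<=` j}.
  move=> i j /subnK <-; elim: (j - i)%N => // k IHk.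
  by rewrite addSn; apply: subset_trans IHk _.
pose U i := f @^-1` (O i).
have oU i : open (U i) by apply: open_comp => // x _; exact: fc.
have UT x : exists i, U i x.
  have : [set: G] (f x) by [].
  by rewrite -O_cover => -[i _ Oi]; exists i.
have [m KU] : exists m, K `<=` U m.
  apply: contrapT => /forallNP KU.
  pose F := filter_from [set: nat] (fun i => K `&` ~` U i).
  have FF : ProperFilter F.
    apply: filter_from_proper => [|i _]; last first.
      by move: (KU i) => /existsNP[x /not_implyP[Kx Ux]]; exists x.
    apply: filter_from_filter; first by exists 0%N.
    move=> i j _ _; exists (maxn i j) => // x [Kx Ux].
    split; split => // Uix; apply: Ux.
      exact: (O_mono _ _ (leq_maxl i j)).
    exact: (O_mono _ _ (leq_maxr i j)).
  have [|x [_ clx]] := cK F FF; first by exists 0%N => // x [].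
  have [i Uix] := UT x.
  have [||y [[_ nUy] Uy]] := clx (K `&` ~` U i) (U i).
  - by exists i.
  - by apply: open_nbhs_nbhs; split.
  - exact: nUy.
exists m => x.
have Pcl := preimage_group_closed (O m) fM.
exact: (genK (Subgroup Pcl)).
Qed.

Lemma residual_morph (G H : topGroupType) (f : H -> G) (x : H) :
  {morph f : x y / (x * y)%g} -> continuous f ->
  @residual_set H x -> @residual_set G (f x).
Proof.
move=> fM fc xR N [oN nN].
have Pcl := preimage_group_closed N fM.
apply: (xR (Subgroup Pcl)); split.
  by apply: open_comp => // y _; exact: fc.
have fV y : f y^-1%g = (f y)^-1%g.
  by apply: (mulgI (f y)); rewrite -fM !mulgV (morph_group1 fM).
by move=> y g /= Ny; rewrite !fM fV; exact: nN.
Qed.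

Lemma has_rank_mono (G H : topGroupType) (f : H -> G) (a b : Ord) :
  {morph f : x y / (x * y)%g} -> injective f -> continuous f ->
  has_rank G a -> has_rank H b -> ord_le b a.
Proof.
move=> fM fI fc rG; elim: rG H f b fM fI fc => {G a}.
  move=> G a G1 [_ a1] H f b fM fI fc.
  move=> rH; case: rH f fM fI fc => {H b} [H b _ [b1 _]|H K c b H1 _ _ _ _] f fM fI fc.
    exact: ord_le_trans b1 a1.
  exfalso; apply: H1; rewrite eqEsubset; split=> // x _ /=; apply: fI.
  have triv y : y = 1%g :> G by have : [set: G] y by []; rewrite G1.
  by rewrite (triv (f x)) (triv (f _)).
move=> G O c a G1 uO _ _ IH [_ ca] H f b fM fI fc.
move=> rH.
case: rH f fM fI fc => {H b} [H b _ [b1 _]|H K e b _ _ gK rK [be _]] f fM fI fc.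
  apply: ord_le_trans ca; apply: ord_le_trans b1 _.
  by apply: ord_le_succ; exact: ord_le0.
apply: ord_le_trans ca; apply: ord_le_trans be _.
apply/ord_le_succ/ord_sup_le => n.
pose k : subgrp (K n) -> G := f \o val.
have kM : {morph k : x y / (x * y)%g} by move=> x y; rewrite /k /= fM.
have kc : continuous k.
  move=> x; apply: continuous_comp; first exact: subgrp_val_continuous.
  exact: fc.
have [m kO] := compactly_generated_sub kM kc uO (gK n).
apply: ord_le_trans (ord_sup_ge c m).
pose h (x : subgrp (K n)) : subgrp (O m) := exist _ (k x) (mem_set (kO x)).
have hM : {morph h : x y / (x * y)%g}.
  by move=> x y; apply: val_inj; rewrite /= -kM.
have hc : continuous h by apply: subgrp_continuous.
have hR (x : subgrp (residual (subgrp (K n)))) :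
    @residual_set (subgrp (O m)) (h (val x)).
  by apply: (@residual_morph _ _ h (val x)) => //; exact: set_mem (valP x).
pose r (x : subgrp (residual (subgrp (K n)))) :
  subgrp (residual (subgrp (O m))) :=
  exist _ (h (val x)) (mem_set (hR x)).
apply: (IH m _ r) (rK n).
- by move=> x y; apply: val_inj; rewrite /= -hM.
- move=> x y /(congr1 val) /= /(congr1 val) /= /fI xy.
  by do 2 apply: val_inj.
- apply: subgrp_continuous => x.
  apply: (@continuous_comp _ _ _ (val : subgrp (residual _) -> subgrp (K n)) h).
    exact: subgrp_val_continuous.
  exact: hc.
Qed.

Lemma has_rank_unique (G : topGroupType) (a b : Ord) :
  has_rank G a -> has_rank G b -> ord_eq a b.
Proof.
by move=> Ga Gb; split; apply: (@has_rank_mono G G id) => // x; exact: cvg_id.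
Qed.

(* Wesolek's xi. The value [omega] off the domain of [has_rank] is junk.      *)
Definition decomposition_rank (G : topGroupType) : Ord :=
  if pselect (exists a, has_rank G a) is left ex then projT1 (cid ex)
  else omega.

Lemma decomposition_rankE (G : topGroupType) (a : Ord) :
  has_rank G a -> ord_eq (decomposition_rank G) a.
Proof.
move=> Ga; rewrite /decomposition_rank; case: pselect => [ex|[]]; last first.
  by exists a.
by case: (cid ex) => b Gb; exact: has_rank_unique Gb Ga.
Qed.

Definition n_bounded (n : nat) (d : Order.disp_t) (L : porderType d) : Prop :=
  forall s : L, ([set t : L | (t <= s)%O || (s <= t)%O] #<= `I_n)%card.

Definition poset_itv (d : Order.disp_t) (L : porderType d) (s t : L) : set L :=
  [set u : L | (s <= u)%O && (u <= t)%O].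

Definition locally_finite (d : Order.disp_t) (L : porderType d) : Prop :=
  forall s t : L, finite_set (poset_itv s t).

Lemma n_bounded_locally_finite (n : nat) (d : Order.disp_t) (L : porderType d) :
  n_bounded n L -> locally_finite L.
Proof.
move=> nL s t; apply: sub_finite_set (card_le_finite (nL s) (finite_II n)).
by move=> u /andP[su _] /=; rewrite su orbT.
Qed.

Definition incidence_set (d : Order.disp_t) (L : porderType d)
    (P : topComNzRingType) : set {ptws L * L -> P} :=
  [set a | forall s t : L, a (s, t) <> 0%R -> (s <= t)%O].

Arguments incidence_set {d} L P _.

(* The argument [finL] only serves to establish the ring axioms.              *)
Definition incidence_ring (d : Order.disp_t) (L : porderType d)
    (finL : locally_finite L) (P : topComNzRingType) : Type :=
  set_type (incidence_set L P).

Section IncidenceRing.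
Variables (d : Order.disp_t) (L : porderType d) (finL : locally_finite L).
Variable P : topComNzRingType.
Implicit Types (s t u v : L).
Local Open Scope ring_scope.

Local Notation M := (incidence_ring finL P).

HB.instance Definition _ := SubChoice.copy M (set_type (incidence_set L P)).
HB.instance Definition _ := Topological.copy M (set_type (incidence_set L P)).

Definition entry (a : M) s t : P := val a (s, t).

Lemma entryP (a b : M) : entry a =2 entry b -> a = b.
Proof. by move=> ab; apply/val_inj/funext => -[s t]; exact: ab. Qed.

Lemma entry_neq0 (a : M) s t : entry a s t <> 0 -> (s <= t)%O.
Proof. by move: (valP a) => /set_mem; apply. Qed.

Lemma entry_eq0 (a : M) s t : ~~ (s <= t)%O -> entry a s t = 0.
Proof. by move=> st; apply: contrapT => /entry_neq0; exact/negP. Qed.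

Lemma incidence_subproof (f : L -> L -> P) :
  (forall s t, ~~ (s <= t)%O -> f s t = 0) ->
  (fun p => f p.1 p.2) \in incidence_set L P.
Proof.
by move=> f0; apply/mem_set => s t /= ft; apply: contrapT => /negP /f0.
Qed.

Definition incidence_of (f : L -> L -> P)
    (f0 : forall s t, ~~ (s <= t)%O -> f s t = 0) : M :=
  exist _ (fun p => f p.1 p.2) (incidence_subproof f0).

Lemma inc_zero_subproof s t : ~~ (s <= t)%O -> (0 : P) = 0.
Proof. by []. Qed.

Lemma inc_opp_subproof (a : M) s t : ~~ (s <= t)%O -> - entry a s t = 0.
Proof. by move=> st; rewrite entry_eq0// oppr0. Qed.

Lemma inc_add_subproof (a b : M) s t :
  ~~ (s <= t)%O -> entry a s t + entry b s t = 0.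
Proof. by move=> st; rewrite !entry_eq0// addr0. Qed.

Lemma inc_one_subproof s t : ~~ (s <= t)%O -> (s == t)%:R = 0 :> P.
Proof. by case: eqP => // ->; rewrite lexx. Qed.

Lemma inc_mul_subproof (a b : M) s t : ~~ (s <= t)%O ->
  \sum_(u \in poset_itv s t) entry a s u * entry b u t = 0.
Proof.
move=> st; apply: fsbig1 => u /andP[su ut].
by rewrite (le_trans su ut) in st.
Qed.

Definition inc_zero : M := incidence_of inc_zero_subproof.
Definition inc_opp (a : M) : M := incidence_of (inc_opp_subproof a).
Definition inc_add (a b : M) : M := incidence_of (inc_add_subproof a b).
Definition inc_one : M := incidence_of inc_one_subproof.
Definition inc_mul (a b : M) : M := incidence_of (inc_mul_subproof a b).

Lemma inc_addA : associative inc_add.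
Proof. by move=> a b c; apply: entryP => s t; exact: addrA. Qed.

Lemma inc_addC : commutative inc_add.
Proof. by move=> a b; apply: entryP => s t; exact: addrC. Qed.

Lemma inc_add0 : left_id inc_zero inc_add.
Proof. by move=> a; apply: entryP => s t; exact: add0r. Qed.

Lemma inc_addN : left_inverse inc_zero inc_opp inc_add.
Proof. by move=> a; apply: entryP => s t; exact: addNr. Qed.

HB.instance Definition _ :=
  GRing.isZmodule.Build M inc_addA inc_addC inc_add0 inc_addN.

Lemma inc_mulE (a b : M) s t (S : set L) : finite_set S ->
  poset_itv s t `<=` S ->
  entry (inc_mul a b) s t = \sum_(u <- fset_set S) entry a s u * entry b u t.
Proof.
move=> finS sub; rewrite {1}/entry /= -fsbig_finite//.
apply: fsbig_widen => // u [_ /negP]; rewrite /= negb_and.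
by move=> /orP[] /entry_eq0 ->; rewrite ?mul0r ?mulr0.
Qed.

Lemma inc_mulA : associative inc_mul.
Proof.
move=> a b c; apply: entryP => s t.
have finI := finL s t.
rewrite !(inc_mulE _ _ finI)//.
transitivity (\sum_(u <- fset_set (poset_itv s t))
    \sum_(v <- fset_set (poset_itv s t))
      entry a s u * (entry b u v * entry c v t)).
  apply: eq_big_seq => u; rewrite in_fset_set// inE => /andP[su ut].
  rewrite (inc_mulE _ _ finI) ?mulr_sumr//.
  by move=> v /andP[uv vt]; apply/andP; split=> //; exact: le_trans uv.
rewrite exchange_big /=.
apply: eq_big_seq => v; rewrite in_fset_set// inE => /andP[sv vt].
rewrite (inc_mulE _ _ finI) ?mulr_suml//.
  by apply: eq_bigr => u _; rewrite mulrA.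
by move=> u /andP[su uv]; apply/andP; split=> //; exact: le_trans vt.
Qed.

Lemma inc_mul1 : left_id inc_one inc_mul.
Proof.
move=> a; apply: entryP => s t.
have finI : finite_set (s |` poset_itv s t).
  by rewrite finite_setU; split; [exact: finite_set1|exact: finL].
rewrite (inc_mulE _ _ finI); last by move=> u; right.
have sI : s \in fset_set (s |` poset_itv s t).
  by rewrite in_fset_set// inE; left.
rewrite (big_fsetD1 _ sI) /=.
rewrite /entry /= eqxx mul1r big1_fset ?addr0// => u.
by rewrite !inE eq_sym => /andP[/negPf ->] _ _; rewrite mul0r.
Qed.

Lemma inc_mulr1 : right_id inc_one inc_mul.
Proof.
move=> a; apply: entryP => s t.
have finI : finite_set (t |` poset_itv s t).
  by rewrite finite_setU; split; [exact: finite_set1|exact: finL].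
rewrite (inc_mulE _ _ finI); last by move=> u; right.
have tI : t \in fset_set (t |` poset_itv s t).
  by rewrite in_fset_set// inE; left.
rewrite (big_fsetD1 _ tI) /=.
rewrite /entry /= eqxx mulr1 big1_fset ?addr0// => u.
by rewrite !inE => /andP[/negPf ->] _ _; rewrite mulr0.
Qed.

Lemma inc_mulDl : left_distributive inc_mul inc_add.
Proof.
move=> a b c; apply: entryP => s t.
rewrite {2}/entry /= -!/(entry _ _ _) !(inc_mulE _ _ (finL s t))// -big_split.
by apply: eq_bigr => u _; exact: mulrDl.
Qed.

Lemma inc_mulDr : right_distributive inc_mul inc_add.
Proof.
move=> a b c; apply: entryP => s t.
rewrite {2}/entry /= -!/(entry _ _ _) !(inc_mulE _ _ (finL s t))// -big_split.
by apply: eq_bigr => u _; exact: mulrDr.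
Qed.

(* The zero ring when [L] is empty, hence only a [pzRingType].                *)
HB.instance Definition _ := GRing.Zmodule_isPzRing.Build M
  inc_mulA inc_mul1 inc_mulr1 inc_mulDl inc_mulDr.

End IncidenceRing.

Definition ring_units (R : pzRingType) : set R :=
  [set a | exists b : R, (a * b = 1 /\ b * a = 1)%R].

Definition unit_grp (R : pzRingType) : Type := set_type (@ring_units R).

Section UnitGroup.
Variable R : pzRingType.
Implicit Types x y z : unit_grp R.
Local Open Scope ring_scope.

HB.instance Definition _ := SubChoice.copy (unit_grp R)
  (set_type (@ring_units R)).

Lemma unit_inv_subproof x : {b : R | val x * b = 1 /\ b * val x = 1}.
Proof. by apply: cid; apply: set_mem (valP x). Qed.

Lemma unit_one_mem : (1 : R) \in @ring_units R.
Proof. by apply/mem_set; exists 1; rewrite mulr1. Qed.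

Lemma unit_mul_mem x y : val x * val y \in @ring_units R.
Proof.
have [[x' [x1 x2]] [y' [y1 y2]]] := (unit_inv_subproof x, unit_inv_subproof y).
apply/mem_set; exists (y' * x').
by rewrite mulrA -(mulrA (val x)) y1 mulr1 x1 mulrA -(mulrA y') x2 mulr1.
Qed.

Lemma unit_inv_mem x : projT1 (unit_inv_subproof x) \in @ring_units R.
Proof.
by apply/mem_set; exists (val x); case: (unit_inv_subproof x) => b /= [].
Qed.

Definition unit_one : unit_grp R := exist _ 1 unit_one_mem.
Definition unit_mul x y : unit_grp R :=
  exist _ (val x * val y) (unit_mul_mem x y).
Definition unit_inv x : unit_grp R :=
  exist _ (projT1 (unit_inv_subproof x)) (unit_inv_mem x).

Lemma unit_mulA : associative unit_mul.
Proof. by move=> x y z; apply: val_inj; exact: mulrA. Qed.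

Lemma unit_mul1 : left_id unit_one unit_mul.
Proof. by move=> x; apply: val_inj; exact: mul1r. Qed.

Lemma unit_mulr1 : right_id unit_one unit_mul.
Proof. by move=> x; apply: val_inj; exact: mulr1. Qed.

Lemma unit_mulV : left_inverse unit_one unit_inv unit_mul.
Proof.
by move=> x; apply: val_inj => /=; case: (unit_inv_subproof x) => b /= [].
Qed.

Lemma unit_mulrV : right_inverse unit_one unit_inv unit_mul.
Proof.
by move=> x; apply: val_inj => /=; case: (unit_inv_subproof x) => b /= [].
Qed.

HB.instance Definition _ := isGroup.Build (unit_grp R)
  unit_mulA unit_mul1 unit_mulr1 unit_mulV unit_mulrV.

End UnitGroup.

Definition GL (d : Order.disp_t) (L : porderType d) (finL : locally_finite L)
    (P : topComNzRingType) : Type := unit_grp (incidence_ring finL P).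

Section GLTopology.
Variables (d : Order.disp_t) (L : porderType d) (finL : locally_finite L).
Variable P : topComNzRingType.

HB.instance Definition _ :=
  Group.copy (GL finL P) (unit_grp (incidence_ring finL P)).
HB.instance Definition _ :=
  Topological.copy (GL finL P) (set_type (@ring_units (incidence_ring finL P))).

End GLTopology.

(* Main.v *)
Require Import Defs.
From HB Require Import structures.
From mathcomp Require Import all_boot all_order all_algebra.
From mathcomp Require Import finmap.
From mathcomp Require Import all_classical all_reals all_analysis.

(** The incidence group is solvable, and a t.d.l.c.s.c. group with an open
    compact solvable subgroup is elementary of finite rank.

    Solvability: the entries of an incidence matrix are layered by the
    cardinality of the interval that they sit on, which is at most [n]. The
    commutator of two units has ones on the diagonal because [P] is
    commutative, and the commutator of two units that agree with the identity
    up to layer [j], for [j > 0], agrees with it up to layer [j.+1], because in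
    that layer the entries of a product add up
    ([unipotent_group_comm], [derived_unipotent_group]). So the [n]-th derived
    subgroup is trivial.

    From solvable to elementary, by induction on the derived length, in the
    relative form of [tame_of_derived_sub]: if [N] is closed and normal in [H]
    and some compact open subgroup [W] of [H] has its [k]-th derived subgroup
    in [N], then [H] is obtained from [N] by boundedly many elementary
    constructions. If [k = 0] then [N] is open. In the step from [k] to
    [k.+1], let [D] consist of the elements of [H] that commute, modulo [N],
    with the [k]-th derived subgroup of some open subgroup of [W]. This [D] is
    normal in [H] and contains the [k]-th derived subgroup of [W], so the case
    [k] climbs from [closure D] to [H]. A compactly generated open subgroup
    [L] of [closure D] is generated by a compact open subgroup and finitely
    many elements of the dense subgroup [D], and these commute modulo [N] with
    the [k]-th derived subgroup of a common [V]. Hence [N `&` L] times the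
    closure of [derived k (V `&` L)] is a normal subgroup [M] of [L], abelian
    modulo [N], and the case [k] climbs from [M] to [L]. Finally [closure D] is
    the union of such [L], with a uniform bound.

    The inductive family [tame] records the constructions. It implies finite
    rank ([tame_rank_le], [has_rank_of_rank_le]) because for [N] open and
    normal, or closed with abelian quotient, the residuals of subgroups of [H]
    fall into [N]; and it implies that the group is elementary
    ([tame_elementary]), where the quotients that occur are countable discrete
    or profinite. The constructions take place among the closed subgroups of
    the given group, seen as subsets of it. *)

Set Implicit Arguments.
Unset Strict Implicit.
Unset Printing Implicit Defensive.

Local Open Scope classical_set_scope.

(** * Subgroups as subsets, and derived subgroups *)

Section SubgroupSets.
Variable G : groupType.
Local Open Scope group_scope.
Implicit Types (A B C H K N S : set G) (x y z g : G).

Definition is_subgroup H := H 1 /\ forall x y, H x -> H y -> H (x * y^-1).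

Lemma is_subgroup1 H : is_subgroup H -> H 1.
Proof. by case. Qed.

Lemma is_subgroupV H x : is_subgroup H -> H x -> H x^-1.
Proof. by move=> [H1 HD] Hx; rewrite -[x^-1]mul1g; exact: HD. Qed.

Lemma is_subgroupM H x y : is_subgroup H -> H x -> H y -> H (x * y).
Proof.
by move=> sH Hx Hy; rewrite -[y]invgK; apply: sH.2 => //; exact: is_subgroupV.
Qed.

Lemma is_subgroupJ H x y : is_subgroup H -> H x -> H y -> H (x ^ y).
Proof.
by move=> sH Hx Hy; rewrite conjgE; do 2 ?apply: is_subgroupM => //;
  exact: is_subgroupV.
Qed.

Lemma is_subgroupR H x y : is_subgroup H -> H x -> H y -> H [~ x, y].
Proof.
by move=> sH Hx Hy; rewrite commgEl; apply: is_subgroupM => //;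
  [exact: is_subgroupV|exact: is_subgroupJ].
Qed.

Lemma is_subgroup_mull H x y : is_subgroup H -> H x -> H (x * y) -> H y.
Proof.
move=> sH Hx Hxy; rewrite -(mulKg x y); apply: is_subgroupM => //.
exact: is_subgroupV.
Qed.

Lemma is_subgroupI H K : is_subgroup H -> is_subgroup K ->
  is_subgroup (H `&` K).
Proof.
move=> sH sK; split=> [|x y [Hx Kx] [Hy Ky]].
  by split; exact: is_subgroup1.
by split; [exact: sH.2|exact: sK.2].
Qed.

Lemma is_subgroup_bigcap (I : Type) (P : set I) (F : I -> set G) :
  (forall i, P i -> is_subgroup (F i)) -> is_subgroup (\bigcap_(i in P) F i).
Proof.
move=> sF; split=> [i /sF[]//|x y Fx Fy i Pi].
by apply: (sF i Pi).2; [exact: Fx|exact: Fy].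
Qed.

Lemma is_subgroupT : is_subgroup [set: G].
Proof. by []. Qed.

Lemma is_subgroup_set1 : is_subgroup [set 1].
Proof. by split=> // x y -> ->; rewrite /= mulgV. Qed.

Definition conj_set A g : set G := [set x | A (x ^ g)].

Lemma is_subgroup_conj H g : is_subgroup H -> is_subgroup (conj_set H g).
Proof.
move=> sH; rewrite /conj_set; split=> [|x y] /=.
  by rewrite conj1g; exact: is_subgroup1.
by rewrite conjMg conjVg; exact: sH.2.
Qed.

Definition normal_in H N :=
  [/\ is_subgroup N, N `<=` H & forall x g, N x -> H g -> N (x ^ g)].

Lemma normal_inR H N x g : normal_in H N -> N x -> H g -> N [~ x, g].
Proof.
move=> [sN _ nN] Nx Hg; rewrite commgEl; apply: is_subgroupM => //.
  exact: is_subgroupV.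
exact: nN.
Qed.

Lemma normal_in_subI H N O : is_subgroup O -> O `<=` H -> normal_in H N ->
  normal_in O (N `&` O).
Proof.
move=> sO OH [sN NH nN]; split; first exact: is_subgroupI.
  by move=> x [].
by move=> x g [Nx Ox] Og; split; [apply: nN => //; exact: OH|exact: is_subgroupJ].
Qed.

Lemma normal_in_refl H : is_subgroup H -> normal_in H H.
Proof. by move=> sH; split=> // x g; exact: is_subgroupJ. Qed.

Definition centralizer_mod H N S : set G :=
  [set x | H x /\ forall s, S s -> N [~ x, s]].

Lemma is_subgroup_centralizer_mod H N S : is_subgroup H -> normal_in H N ->
  S `<=` H -> is_subgroup (centralizer_mod H N S).
Proof.
move=> sH nN SH; have [sN _ nNJ] := nN; split.
  split; first exact: is_subgroup1.
  by move=> s _; rewrite comm1g; exact: is_subgroup1.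
move=> x y [Hx cx] [Hy cy]; split; first exact: sH.2.
move=> s Ss.
(* a conjugate, by an element of H, of an element of N *)
have -> : [~ x * y^-1, s] = ([~ x, s] * [~ y, s]^-1) ^ y^-1.
  by rewrite !commgEl !conjgE !invgM !invgK !mulgA !(mulgK, mulgVK).
apply: nNJ; last exact: is_subgroupV.
by apply: sN.2; [exact: cx|exact: cy].
Qed.

Definition generated A : set G :=
  \bigcap_(H in [set H | is_subgroup H /\ A `<=` H]) H.

Lemma is_subgroup_generated A : is_subgroup (generated A).
Proof. by apply: is_subgroup_bigcap => H []. Qed.

Lemma sub_generated A : A `<=` generated A.
Proof. by move=> x Ax H [_]; exact. Qed.

Lemma generated_sub A H : is_subgroup H -> A `<=` H -> generated A `<=` H.
Proof. by move=> sH AH x; exact. Qed.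

Lemma generatedS A B : A `<=` B -> generated A `<=` generated B.
Proof.
move=> AB; apply: generated_sub; first exact: is_subgroup_generated.
by apply: subset_trans AB _; exact: sub_generated.
Qed.

Lemma generated_conj A g : conj_set (generated A) g `<=` generated (conj_set A g).
Proof.
move=> x /= gx H [sH AH].
suff : generated A `<=` conj_set H g^-1.
  by move=> /(_ _ gx); rewrite /conj_set /= conjgK.
apply: generated_sub; first exact: is_subgroup_conj.
by move=> y Ay; apply: AH; rewrite /conj_set /= conjgKV.
Qed.

Fixpoint derived k S : set G :=
  if k is k'.+1 then
    generated [set z | exists x y,
      [/\ derived k' S x, derived k' S y & z = [~ x, y]]]
  else S.

Lemma derived_sub k H : is_subgroup H -> derived k H `<=` H.
Proof.
move=> sH; elim: k => //= k IH; apply: generated_sub => // _ [x [y [/IH Hx /IH Hy ->]]].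
exact: is_subgroupR.
Qed.

Lemma is_subgroup_derived k H : is_subgroup H -> is_subgroup (derived k H).
Proof. by move=> sH; case: k => //= k; exact: is_subgroup_generated. Qed.

Lemma derivedS k A B : A `<=` B -> derived k A `<=` derived k B.
Proof.
move=> AB; elim: k => //= k IH; apply: generatedS => _ [x [y [/IH Hx /IH Hy ->]]].
by exists x, y.
Qed.

Lemma derived_comm k A x y : derived k A x -> derived k A y ->
  derived k.+1 A [~ x, y].
Proof. by move=> Ax Ay; apply: sub_generated; exists x, y. Qed.

Lemma derived_conj k A g : conj_set (derived k A) g `<=` derived k (conj_set A g).
Proof.
elim: k => //= k IH; apply: subset_trans (@generated_conj _ _) _.
apply: generatedS => z [x [y [Ax Ay zE]]].
exists (x ^ g^-1), (y ^ g^-1); split.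
- by apply: IH; rewrite /conj_set /= conjgKV.
- by apply: IH; rewrite /conj_set /= conjgKV.
- by rewrite -conjRg -zE conjgK.
Qed.

Lemma derived_conjJ k A g x : derived k A x ->
  derived k (conj_set A g^-1) (x ^ g).
Proof. by move=> Ax; apply: derived_conj; rewrite /conj_set /= conjgK. Qed.

End SubgroupSets.

Arguments derived_sub {G} k [H] _ [t] _.

(** * Open, closed and compact subgroups *)

Section TopologicalGroups.
Variable G : topGroupType.
Local Open Scope group_scope.
Implicit Types (A B C D H K N S V W : set G) (x y z g : G).

Lemma mulg_cvg (T : topologicalType) (f h : T -> G) (t : T) :
  {for t, continuous f} -> {for t, continuous h} ->
  {for t, continuous (fun u => f u * h u)}.
Proof.
move=> cf ch.
apply: (@continuous_comp _ _ _ (fun u => (f u, h u)) (fun x : G * G => x.1 * x.2)).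
  exact: cvg_pair.
exact: mulg_continuous.
Qed.

Lemma invg_cvg (T : topologicalType) (f : T -> G) (t : T) :
  {for t, continuous f} -> {for t, continuous (fun u => (f u)^-1)}.
Proof.
move=> cf; apply: (@continuous_comp _ _ _ f (fun x : G => x^-1)) => //.
exact: invg_continuous.
Qed.

Lemma cst_cvg (T : topologicalType) (x : G) (t : T) :
  {for t, continuous (fun _ : T => x)}.
Proof. exact: cvg_cst. Qed.

Lemma id_cvg (x : G) : {for x, continuous (fun y : G => y)}.
Proof. exact: cvg_id. Qed.

Lemma mulgl_continuous g : continuous (fun x : G => g * x).
Proof. by move=> x; apply: mulg_cvg; [exact: cst_cvg|exact: id_cvg]. Qed.

Lemma conjg_continuous g : continuous (fun x : G => x ^ g).
Proof.
move=> x; change {for x, continuous (fun y : G => g^-1 * (y * g))}.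
apply: mulg_cvg; first exact: cst_cvg.
by apply: mulg_cvg; [exact: id_cvg|exact: cst_cvg].
Qed.

Lemma commg_cvg (T : topologicalType) (f h : T -> G) (t : T) :
  {for t, continuous f} -> {for t, continuous h} ->
  {for t, continuous (fun u => [~ f u, h u])}.
Proof.
move=> cf ch.
change {for t, continuous (fun u => (f u)^-1 * ((h u)^-1 * (f u * h u)))}.
apply: mulg_cvg; first exact: invg_cvg.
by apply: mulg_cvg; [exact: invg_cvg|exact: mulg_cvg].
Qed.

Lemma nbhs_translate A x : nbhs 1 A -> nbhs x [set y | A (x^-1 * y)].
Proof. by move=> nA; apply: mulgl_continuous; rewrite mulVg. Qed.

Lemma nbhs_conj A g : nbhs 1 A -> nbhs 1 (conj_set A g).
Proof. by move=> nA; apply: conjg_continuous; rewrite conj1g. Qed.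

Lemma open_subgroup_nbhs H : open H -> is_subgroup H -> nbhs 1 H.
Proof. by move=> oH [H1 _]; exact: open_nbhs_nbhs. Qed.

Lemma open_subgroup H : is_subgroup H -> nbhs 1 H -> open H.
Proof.
move=> sH nH; rewrite openE => x Hx; rewrite /interior.
apply: filterS (nbhs_translate x nH) => y /= Hxy.
by apply: (is_subgroup_mull sH _ Hxy); exact: is_subgroupV.
Qed.

Lemma open_subgroup_closed H : is_subgroup H -> open H -> closed H.
Proof.
move=> sH oH x clx.
have [y [Hy /= Hxy]] := clx _ (nbhs_translate x (open_subgroup_nbhs oH sH)).
rewrite -[x](mulVKg y) -[y^-1 * x]invgK invgM invgK.
by apply: sH.2.
Qed.

Lemma is_subgroup_closure H : is_subgroup H -> is_subgroup (closure H).
Proof.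
move=> sH; split; first by apply: subset_closure; exact: is_subgroup1.
move=> x y clx cly A nA.
have : {for (x, y), continuous (fun u : G * G => u.1 * u.2^-1)}.
  by apply: mulg_cvg; [exact: cvg_fst|apply: invg_cvg; exact: cvg_snd].
move=> /(_ A nA) [[U V] /= [nU nV] UV].
have [u [Hu Uu]] := clx _ nU; have [v [Hv Vv]] := cly _ nV.
exists (u * v^-1); split; first exact: sH.2.
exact: (UV (u, v)).
Qed.

Lemma closure_image_sub A B (f : G -> G) : continuous f -> closed B ->
  (forall x, A x -> B (f x)) -> forall x, closure A x -> B (f x).
Proof.
move=> cf cB AB x clx; apply: cB => U /cf nU.
by have [y [Ay Uy]] := clx _ nU; exists (f y); split=> //; exact: AB.
Qed.

Lemma commg_closure_sub A B N : closed N ->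
  (forall x y, A x -> B y -> N [~ x, y]) ->
  forall x y, closure A x -> closure B y -> N [~ x, y].
Proof.
move=> cN AB x y clx.
apply: (@closure_image_sub B N (fun y => [~ x, y])) => //.
  by move=> z; apply: commg_cvg; [exact: cst_cvg|exact: id_cvg].
move=> {}y By; move: x clx.
apply: (@closure_image_sub A N (fun x => [~ x, y])) => //.
  by move=> z; apply: commg_cvg; [exact: id_cvg|exact: cst_cvg].
by move=> x Ax; exact: AB.
Qed.

Lemma closure_normal H D : normal_in H D -> closed H ->
  normal_in H (closure D).
Proof.
move=> [sD DH nD] cH; split; first exact: is_subgroup_closure.
  by move/closure_id: cH => ->; exact: closureS.
move=> x g clx Hg; move: x clx.
apply: (@closure_image_sub D (closure D) (fun x => x ^ g)).
- exact: conjg_continuous.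
- exact: closed_closure.
- by move=> x Dx; apply: subset_closure; exact: nD.
Qed.

Definition product_set A B : set G :=
  [set z | exists2 x, A x & exists2 y, B y & z = x * y].

(** For [z] outside [N C], the condition [z c^-1 \notin N] is open in [z] and
    [c], hence uniform in [c] by compactness. *)
Lemma closed_mul_compact N C : closed N -> compact C ->
  closed (product_set N C).
Proof.
move=> cN /compact_near_coveringP cC.
rewrite -[product_set _ _]setCK; apply: open_closedC; rewrite openE => z nz.
have : \forall z' \near z, C `<=` (fun c => ~ N (z' * c^-1)).
  apply: (cC G (nbhs z) (fun z' c => ~ N (z' * c^-1)) (nbhs_filter z)) => c Cc.
  have ct : {for (c, z), continuous (fun u : G * G => u.2 * u.1^-1)}.
    by apply: mulg_cvg; [exact: cvg_snd|apply: invg_cvg; exact: cvg_fst].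
  apply: (ct (~` N)); apply: open_nbhs_nbhs; split; first exact: closed_openC.
  move=> /= Nzc; apply: nz; exists (z * c^-1) => //; exists c => //.
  by rewrite mulgVK.
rewrite /interior; apply: filterS => z' Hz' [x Nx [y Cy zE]].
by apply: (Hz' y Cy); rewrite zE mulgK.
Qed.

Lemma normal_in_product H N K : is_subgroup H -> normal_in H N ->
  is_subgroup K -> K `<=` H -> is_subgroup (product_set N K).
Proof.
move=> sH [sN NH nN] sK KH; split.
  exists 1; first exact: is_subgroup1.
  by exists 1; [exact: is_subgroup1|rewrite mulg1].
move=> _ _ [n Nn [k Kk ->]] [n' Nn' [k' Kk' ->]].
exists (n * (n'^-1 ^ (k * k'^-1)^-1)).
  apply: is_subgroupM => //; apply: nN; first exact: is_subgroupV.
  by apply: is_subgroupV => //; apply: sH.2; exact: KH.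
exists (k * k'^-1); first exact: sK.2.
by rewrite invgM !conjgE !invgM !invgK !mulgA !(mulgVK, mulgK).
Qed.

(** A compact group of conjugators preserves some smaller open subgroup: the
    condition [W (x ^ c)] near [x = 1] is uniform in [c]. *)
Lemma open_core K W : is_subgroup K -> compact K -> is_subgroup W -> open W ->
  exists V, [/\ is_subgroup V, open V, V `<=` W &
    forall x g, V x -> K g -> V (x ^ g)].
Proof.
move=> sK cK sW oW; pose V := [set x | forall c, K c -> W (x ^ c)].
have sV : is_subgroup V.
  split=> [c _|x y Vx Vy c Kc]; first by rewrite conj1g; exact: is_subgroup1.
  by rewrite conjMg conjVg; apply: sW.2; [exact: Vx|exact: Vy].
exists V; split=> //.
- apply: open_subgroup => //.
  have /compact_near_coveringP/(_ G (nbhs (1 : G)) (fun x c => W (x ^ c)) (nbhs_filter _)) := cK.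
  apply => c Kc.
  have ct : {for (c, 1), continuous (fun u : G * G => u.2 ^ u.1)}.
    change {for (c, 1), continuous (fun u : G * G => u.1^-1 * (u.2 * u.1))}.
    apply: mulg_cvg; first by apply: invg_cvg; exact: cvg_fst.
    by apply: mulg_cvg; [exact: cvg_snd|exact: cvg_fst].
  by apply: (ct W); rewrite /= conj1g; exact: open_subgroup_nbhs.
- by move=> x /(_ 1 (is_subgroup1 sK)); rewrite conjg1.
- by move=> x g Vx Kg c Kc; rewrite -conjgM; apply: Vx; exact: is_subgroupM.
Qed.

(** For a subgroup [O] of [H] this is openness in the subspace topology, which
    need only be tested at the identity. *)
Definition relatively_open H O := exists2 A, nbhs 1 A & A `&` H `<=` O.

Definition compactly_generated_set H :=
  exists2 K, compact K & H = generated K.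

Lemma relatively_open_closed H O : is_subgroup O -> O `<=` H ->
  relatively_open H O -> closed H -> is_subgroup H -> closed O.
Proof.
move=> sO OH [A nA AO] cH sH x clx.
have Hx : H x by move: x clx; move/closure_id: cH => ->; exact: closureS.
have [y [Oy Ay]] := clx _ (nbhs_translate x nA).
rewrite -[x](mulVKg y) -[y^-1 * x]invgK invgM invgK.
apply: sO.2 => //; apply: AO; split=> //.
by apply: is_subgroupM => //; [exact: is_subgroupV|exact: OH].
Qed.

End TopologicalGroups.

Section VanDantzig.

(** In a compact Hausdorff space the intersection of the clopen neighbourhoods
    of a point is connected, so total disconnectedness gives clopen
    separation. *)
Lemma compact_totally_disconnected_zero_dimensional (T : topologicalType) :
  compact [set: T] -> hausdorff_space T -> totally_disconnected [set: T] ->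
  zero_dimensional T.
Proof.
move=> cT hT tdT x y xy; apply: contrapT => nsep.
pose Q := \bigcap_(U in [set U : set T | clopen U /\ U x]) U.
have Qx : Q x by move=> U [].
have Qy : Q y.
  move=> U [cU Ux]; apply: contrapT => Uy; apply: nsep.
  by exists U; split.
have cQ : closed Q by apply: closed_bigI => U [[]].
suff conQ : connected Q.
  have : connected_component [set: T] x y by exists Q.
  by rewrite tdT// => yx; move: xy; rewrite yx eqxx.
apply/connectedP => E [E0 QE [sE1 sE2]].
have clE b : closed (E b).
  have EQ : closure (E b) `<=` Q.
    rewrite [X in _ `<=` X](closure_id _).1//; apply: closureS; rewrite QE.
    by case: b => z; [right|left].
  move=> z clz; have := EQ _ clz; rewrite {1}QE => -[]; case: b clz EQ => //.
    by move=> clz _ Ez; have : (E false `&` closure (E true)) z by []; rewrite sE2.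
  by move=> clz _ Ez; have : (closure (E false) `&` E true) z by []; rewrite sE1.
have [b Eb] : exists b, E b x.
  by move: Qx; rewrite QE => -[]; [exists false|exists true].
have dE : E b `&` E (~~ b) = set0.
  rewrite -subset0 => z [z1 z2].
  have : (closure (E false) `&` E true) z.
    by case: b {Eb} z1 z2 => z1 z2; split => //; apply: subset_closure.
  by rewrite sE1.
have : set_nbhs (E b) (~` E (~~ b)).
  move=> z Ez; apply: open_nbhs_nbhs; split; first exact: closed_openC.
  by move: z Ez; apply/disjoints_subset.
move=> /(compact_normal hT cT (clE b))[U EV UE].
pose V := interior U.
have oV : open V by exact: open_interior.
have VU : V `<=` U by exact: interior_subset.
have [C [[oC clC] Cx] CV] : exists2 C : set T, clopen C /\ C x &
    C `&` (closure U `\` V) = set0.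
  apply: contrapT => noC.
  (* otherwise the traces of the clopen sets on the boundary cluster at a
     point of Q *)
  pose F := filter_from [set C : set T | clopen C /\ C x]
    (fun C => C `&` (closure U `\` V)).
  have FF : ProperFilter F.
    apply: filter_from_proper => [|C Cx]; last first.
      by apply/set0P/negP => /eqP CV; apply: noC; exists C.
    apply: filter_from_filter; first by exists setT; split=> //; exact: clopenT.
    move=> C D [cC Cx] [cD Dx]; exists (C `&` D).
      by split; [exact: clopenI|split].
    by move=> z [[]].
  have cptB : compact (closure U `\` V).
    apply: (subclosed_compact _ cT) => //.
    rewrite setDE; apply: closedI; first exact: closed_closure.
    exact: open_closedC.
  have [|z [[Uz Vz] clz]] := cptB F FF; first by exists setT => [|z []//]; split=> //; exact: clopenT.
  have Qz : Q z.
    move=> C [clC Cx]; apply: (clC.2) => W nW.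
    have FC : F (C `&` (closure U `\` V)).
      by exists C => //; split.
    by have [w [[Cw _] Ww]] := clz _ W FC nW; exists w.
  have {Qz} [Ez|/UE//] : E b z \/ E (~~ b) z.
    by move: Qz; rewrite QE; case: (b) => -[] /= ?; by [left|right].
  by apply: Vz; exact: EV.
(* C misses the boundary, so its trace on V is again clopen *)
have CUV : C `&` V = C `&` closure U.
  apply/seteqP; split=> z [Cz].
    by move=> Vz; split=> //; apply: subset_closure; exact: VU.
  move=> Uz; split=> //; apply: contrapT => Vz.
  by have : (C `&` (closure U `\` V)) z by []; rewrite CV.
have [z Ez] := E0 (~~ b).
have Qz : Q z by rewrite QE; move: Ez; case: (b) => /=; [left|right].
have [] // : (C `&` V) z; last first.
  by move=> _ /VU/subset_closure/UE.
apply: Qz; split; last by split=> //; exact: EV.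
by split; [exact: openI|rewrite CUV; apply: closedI => //; exact: closed_closure].
Qed.


End VanDantzig.

(** * Small open subgroups, and embeddings onto a subset *)

Section SmallSubgroups.
Local Open Scope group_scope.

Definition has_small_open_subgroups (G : topGroupType) := forall A : set G,
  nbhs 1 A -> exists V, [/\ is_subgroup V, open V & V `<=` A].

(** A clopen neighbourhood [C] of the identity contains its own stabilizer,
    which is open because [C] and its complement are compact. *)
Lemma compact_small_open_subgroups (G : topGroupType) :
  compact [set: G] -> hausdorff_space G -> totally_disconnected [set: G] ->
  has_small_open_subgroups G.
Proof.
move=> cG hG tdG A nA.
have zG := compact_totally_disconnected_zero_dimensional cG hG tdG.
have [C [C1 [oC clC]] CA] := zero_dimensional_cvg hG zG cG nA.
pose V := [set x : G | forall y, C (x * y) <-> C y].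
have sV : is_subgroup V.
  split=> [y|x y Vx Vy z]; first by rewrite mul1g.
  by rewrite -mulgA (Vx _) -(Vy _) mulVKg.
have stab (D : set G) : open D -> closed D ->
    \forall x \near (1 : G), D `<=` (fun y => D (x * y)).
  move=> oD clD.
  have /compact_near_coveringP/(_ G (nbhs (1 : G)) (fun x y => D (x * y))
    (nbhs_filter _)) : compact D by exact: (subclosed_compact clD cG).
  apply=> y Dy.
  have ct : {for (y, 1), continuous (fun u : G * G => u.2 * u.1)}.
    by apply: mulg_cvg; [exact: cvg_snd|exact: cvg_fst].
  by apply: (ct D); rewrite /= mul1g; exact: open_nbhs_nbhs.
exists V; split=> //; last first.
  by move=> x /(_ 1)[_]; rewrite mulg1 => /(_ C1); exact: CA.
apply: open_subgroup => //.
have nC := stab _ (closed_openC clC) (open_closedC oC).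
apply: filterS2 (stab _ oC clC) nC => x Cx nCx y; split; last exact: Cx.
by move=> Cxy; apply: contrapT => /nCx.
Qed.

End SmallSubgroups.

Section Embeddings.
Local Open Scope group_scope.

Definition residual_in (G : topGroupType) (H : set G) : set G :=
  \bigcap_(N in [set N | normal_in H N /\ relatively_open H N]) N.

(** Iterated subgroups and their residuals are handled as subsets of one
    ambient group. An embedding with prescribed image transports results
    about such a subset to the abstract topological groups that realize it. *)
Definition embedding_onto (T G : topGroupType) (f : T -> G) (H : set G) :=
  [/\ {morph f : x y / x * y}, injective f, continuous f,
      forall A, open A -> exists2 B, open B & A = f @^-1` B
    & range f = H].

Lemma is_subgroupE (G : topGroupType) (H : set G) :
  is_subgroup H <-> group_closed (mem H).
Proof.
split=> -[H1 HD]; split.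
- exact/mem_set.
- by move=> x y; rewrite !inE; exact: HD.
- exact/set_mem.
- by move=> x y Hx Hy; apply/set_mem; apply: HD; exact/mem_set.
Qed.

Definition subgroup_of (G : topGroupType) (H : set G) (sH : is_subgroup H) :=
  Subgroup ((is_subgroupE H).1 sH).

Lemma subgroup_is_subgroup (G : topGroupType) (H : subgroup G) :
  is_subgroup (H : set G).
Proof. by apply/is_subgroupE; exact: subgroup_closed. Qed.

Lemma embedding_val (G : topGroupType) (H : subgroup G) :
  embedding_onto (val : subgrp H -> G) H.
Proof.
split=> //.
- exact: subgrp_val_continuous.
- by move=> A [B oB <-]; exists B.
- apply/seteqP; split=> [_ [x _ <-]|x Hx]; first exact: set_mem (valP x).
  by exists (exist _ x (mem_set Hx)).
Qed.

Lemma embedding_id (G : topGroupType) :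
  embedding_onto (@id G) [set: G].
Proof.
by split=> //; [exact: id_cvg|move=> A oA; exists A|rewrite image_id].
Qed.

Lemma embedding_comp (S T G : topGroupType) (h : S -> T) (f : T -> G) K H :
  embedding_onto h K -> embedding_onto f H -> embedding_onto (f \o h) (f @` K).
Proof.
move=> [hM hI hc ho hK] [fM fI fc fo fH]; split.
- by move=> x y /=; rewrite hM fM.
- exact: inj_comp.
- by move=> x; apply: continuous_comp; [exact: hc|exact: fc].
- by move=> A /ho[B /fo[C oC ->] ->]; exists C.
- by rewrite -hK image_comp.
Qed.

Section Onto.
Variables (T G : topGroupType) (f : T -> G) (H : set G).
Hypothesis fH : embedding_onto f H.
Let fM : {morph f : x y / x * y} := let: And5 p _ _ _ _ := fH in p.
Let fI : injective f := let: And5 _ p _ _ _ := fH in p.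
Let fc : continuous f := let: And5 _ _ p _ _ := fH in p.

Lemma embedding1 : f 1 = 1.
Proof. exact: morph_group1. Qed.

Lemma embeddingV x : f x^-1 = (f x)^-1.
Proof. by apply: (mulgI (f x)); rewrite -fM !mulgV embedding1. Qed.

Lemma embeddingJ x y : f (x ^ y) = f x ^ f y.
Proof. by rewrite !conjgE !fM embeddingV. Qed.

Lemma embeddingR x y : f [~ x, y] = [~ f x, f y].
Proof. by rewrite !commgEl fM embeddingV embeddingJ. Qed.

Lemma embedding_in x : H (f x).
Proof. by case: fH => _ _ _ _ <-; exists x. Qed.

Lemma embedding_onto_ex y : H y -> exists x, f x = y.
Proof. by case: fH => _ _ _ _ <- -[x _ <-]; exists x. Qed.

Lemma embedding_subgroup (K : set T) : is_subgroup K -> is_subgroup (f @` K).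
Proof.
move=> sK; split; first by exists 1; [exact: is_subgroup1|exact: embedding1].
move=> _ _ [x Kx <-] [y Ky <-]; exists (x * y^-1); first exact: sK.2.
by rewrite fM embeddingV.
Qed.

Lemma preimage_subgroup (K : set G) : is_subgroup K -> is_subgroup (f @^-1` K).
Proof.
move=> sK; split=> [|x y Kx Ky] /=; first by rewrite embedding1; exact: is_subgroup1.
by rewrite fM embeddingV; exact: sK.2.
Qed.

Lemma embedding_range_subgroup : is_subgroup H.
Proof.
case: fH => _ _ _ _ <-; exact: (embedding_subgroup (@is_subgroupT T)).
Qed.

Lemma embedding_preimageK (K : set G) : K `<=` H -> f @` (f @^-1` K) = K.
Proof.
move=> KH; apply/seteqP; split=> [_ [x Kx <-]//|y Ky].
by have [x xy] := embedding_onto_ex (KH _ Ky); exists x => //=; rewrite xy.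
Qed.

Lemma embedding_image_sub (K : set T) : f @` K `<=` H.
Proof. by move=> _ [x _ <-]; exact: embedding_in. Qed.

Lemma embedding_open (A : set T) : open A ->
  exists2 B, open B & A = f @^-1` B.
Proof. by case: fH => _ _ _ + _; exact. Qed.

Lemma embedding_preimage_open (B : set G) : open B -> open (f @^-1` B).
Proof. by move=> oB; apply: open_comp => // x _; exact: fc. Qed.

Lemma embedding_preimage_closed (B : set G) : closed B -> closed (f @^-1` B).
Proof. by move=> cB; apply: preimage_closed => // x _; exact: fc. Qed.

Lemma embedding_nbhs x (A : set T) : nbhs x A ->
  exists2 B, nbhs (f x) B & f @^-1` B `<=` A.
Proof.
rewrite nbhsE => -[D [oD Dx] DA]; have [B oB DE] := embedding_open oD.
exists B; last by rewrite -DE.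
by apply: open_nbhs_nbhs; split=> //; rewrite DE in Dx.
Qed.

Lemma embedding_relatively_open (K : set T) :
  nbhs 1 K -> relatively_open H (f @` K).
Proof.
move=> /embedding_nbhs[B nB BK]; exists B; first by rewrite -embedding1.
move=> y [By /embedding_onto_ex[x xy]]; exists x => //; apply: BK.
by rewrite /= xy.
Qed.

Lemma preimage_relatively_open (K : set G) :
  relatively_open H K -> nbhs 1 (f @^-1` K).
Proof.
move=> [A nA AK].
have : nbhs 1 (f @^-1` A) by apply: fc; rewrite embedding1.
by apply: filterS => x Ax; apply: AK; split=> //; exact: embedding_in.
Qed.

Lemma embedding_normal (K : set T) :
  is_subgroup K -> (forall x g, K x -> K (x ^ g)) -> normal_in H (f @` K).
Proof.
move=> sK nK; split; first exact: embedding_subgroup.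
  exact: embedding_image_sub.
move=> _ g [x Kx <-] /embedding_onto_ex[y <-]; exists (x ^ y); first exact: nK.
exact: embeddingJ.
Qed.

Lemma preimage_normal (N : set G) : normal_in H N ->
  forall x g, (f @^-1` N) x -> (f @^-1` N) (x ^ g).
Proof.
move=> [_ _ nN] x g Nx; rewrite /= embeddingJ; apply: nN => //.
exact: embedding_in.
Qed.

(** The residual is intrinsic, so it may be computed with the relatively open
    normal subgroups of the image. *)
Lemma embedding_residual : f @` (@residual_set T) = residual_in H.
Proof.
apply/seteqP; split=> [_ [x Rx <-] N [nN oN]|y Ry].
  have sP : is_subgroup (f @^-1` N) by case: nN => sN _ _; exact: preimage_subgroup.
  apply: (Rx (subgroup_of sP)); split.
    by apply: open_subgroup => //; exact: preimage_relatively_open.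
  by move=> z g; exact: preimage_normal.
have Hy : H y.
  apply: Ry; split; first exact: (normal_in_refl embedding_range_subgroup).
  by exists setT; [exact: filterT|move=> z []].
have [x xy] := embedding_onto_ex Hy; exists x => // N [oN nN].
have sN := subgroup_is_subgroup N.
suff : (f @` N) y by rewrite -xy => -[z Nz /fI <-].
apply: Ry; split; first by apply: embedding_normal => // z g; exact: nN.
by apply: embedding_relatively_open; exact: open_subgroup_nbhs.
Qed.

Lemma embedding_compact (C : set G) : C `<=` H -> compact C ->
  compact (f @^-1` C).
Proof.
move=> CH cC F FF FC.
have [//|y [Cy cly]] := cC _ (fmap_proper_filter f FF).
have [x xy] := embedding_onto_ex (CH _ Cy).
exists x; split; first by rewrite /= xy.
move=> A B FA /embedding_nbhs[D nD DB].
have fA : F (f @^-1` (f @` A)) by apply: filterS FA => z Az; exists z.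
rewrite xy in nD; have [_ [[z Az <-] Dz]] := cly _ _ fA nD.
by exists z; split=> //; exact: DB.
Qed.

Lemma embedding_image_closed (A : set T) : closed H -> closed A ->
  closed (f @` A).
Proof.
move=> cH cA y cly.
have Hy : H y.
  by apply: cH; apply: closureS cly; exact: embedding_image_sub.
have [x xy] := embedding_onto_ex Hy; exists x => //; apply: cA => B.
move=> /embedding_nbhs[D nD DB]; rewrite xy in nD.
by have [_ [[z Az <-] Dz]] := cly _ nD; exists z; split=> //; exact: DB.
Qed.

Lemma embedding_small : has_small_open_subgroups G -> has_small_open_subgroups T.
Proof.
move=> sG A /embedding_nbhs[B nB BA]; rewrite embedding1 in nB.
have [V [sV oV VB]] := sG B nB; exists (f @^-1` V); split.
- exact: preimage_subgroup.
- exact: embedding_preimage_open.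
- by move=> x Vx; apply: BA; exact: VB.
Qed.

Lemma embedding_hausdorff : hausdorff_space G -> hausdorff_space T.
Proof.
move=> hG p q pq; apply: fI; apply: hG => A B /fc nA /fc nB.
by have [x [Ax Bx]] := pq _ _ nA nB; exists (f x).
Qed.

Lemma embedding_tdlcsc : closed H -> tdlcsc G -> tdlcsc T.
Proof.
move=> cH [tdG lcG scG hG]; split; last exact: embedding_hausdorff.
- move=> x _; apply/seteqP; split=> [y [C [Cx _ conC] Cy]|_ ->]; last first.
    exact: connected_component_refl.
  apply: fI; suff : connected_component [set: G] (f x) (f y) by rewrite tdG.
  exists (f @` C); last by exists y.
  split; [by exists x|by []|].
  apply: connected_continuous_connected => //.
  exact: continuous_subspaceT.
- move=> x _; have [B] := lcG (f x) I.
  rewrite withinET => nB [cB clB].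
  exists (f @^-1` (B `&` H)).
    have nfB : nbhs x (f @^-1` B) by exact: fc.
    rewrite withinET; apply: filterS nfB => y By; split=> //.
    exact: embedding_in.
  split; last by apply: embedding_preimage_closed; exact: closedI.
  apply: embedding_compact; first by move=> y [].
  by apply: (subclosed_compact _ cB); [exact: closedI|move=> y []].
- have [B cB [oB bB]] := scG.
  exists ((fun b => f @^-1` b) @` B); first exact: sub_countable (card_image_le _ _) cB.
  split=> [_ [b /oB ob <-]|x A /embedding_nbhs[D /bB[b [Bb bx] bD] DA]].
    exact: embedding_preimage_open.
  exists (f @^-1` b); first by split=> //; exists b.
  by move=> y by_; apply: DA; exact: bD.
Qed.

Lemma embedding_generated (K : set T) : f @` generated K = generated (f @` K).
Proof.
apply/seteqP; split=> [_ [x Kx <-] L [sL KL]|].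
  apply: (Kx (f @^-1` L)); split; first exact: preimage_subgroup.
  by move=> y Ky; apply: KL; exists y.
apply: generated_sub.
  by apply: embedding_subgroup; exact: is_subgroup_generated.
by apply: image_subset; exact: sub_generated.
Qed.

Lemma embedding_compactly_generated :
  compactly_generated T <-> compactly_generated_set H.
Proof.
split=> [[K cK KT]|[K cK HK]].
  exists (f @` K).
    by apply: continuous_compact => //; exact: continuous_subspaceT.
  rewrite -embedding_generated.
  have -> : generated K = [set: T].
    apply/seteqP; split=> // x Tx.
    apply: (KT (subgroup_of (is_subgroup_generated K))) => //.
    exact: sub_generated.
  by case: fH.
have KH : K `<=` H by rewrite HK; exact: sub_generated.
exists (f @^-1` K); first exact: embedding_compact.
move=> L KL x _; have : H (f x) by exact: embedding_in.
rewrite HK -(embedding_preimageK KH) -embedding_generated => -[y + /fI <-].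
by move: y; apply: generated_sub => //; exact: subgroup_is_subgroup.
Qed.

End Onto.
End Embeddings.

(** * From derived length to elementary constructions *)

Section Tame.
Variable G : topGroupType.
Local Open Scope group_scope.
Implicit Types (C D H K N M S V W : set G) (m k : nat).

(** The groups obtained from the trivial group by constructions that keep the
    rank finite and stay in the class of elementary groups: the index bounds
    the number of steps that may raise the rank. In [tame_abelian] the quotient
    is compact and abelian, in [tame_union] one bound serves all subgroups. *)
Inductive tame : nat -> set G -> Prop :=
| tame_trivial : tame 0 [set 1]
| tame_subgroup m H K :
    is_subgroup K -> closed K -> K `<=` H -> tame m H -> tame m K
| tame_open m H N :
    is_subgroup H -> closed H -> normal_in H N -> relatively_open H N ->
    tame m N -> tame m.+1 H
| tame_abelian m H N C :
    is_subgroup H -> closed H -> normal_in H N -> closed N ->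
    (forall x y, H x -> H y -> N [~ x, y]) ->
    compact C -> H = product_set N C -> tame m N -> tame m.+1 H
| tame_union m H :
    is_subgroup H -> closed H ->
    (forall K, is_subgroup K -> K `<=` H -> relatively_open H K ->
      compactly_generated_set K -> tame m K) ->
    tame m.+1 H.

(** For [k = 0] and trivial [N] this is the quasi-centre, the set of elements
    with open centralizer. Allowing [V] to shrink is what makes it normal:
    a conjugate of [V] is another open subgroup, while no single [V] need be
    normalized by [H]. *)
Definition local_centralizer k W H N : set G :=
  [set g | H g /\ exists V, [/\ is_subgroup V, open V, V `<=` W &
    forall s, derived k (V `&` H) s -> N [~ g, s]]].

Lemma local_centralizer_normal k W H N :
  is_subgroup H -> normal_in H N -> is_subgroup W -> open W ->
  normal_in H (local_centralizer k W H N).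
Proof.
move=> sH nN sW oW; have [sN NH nNJ] := nN.
have dH V : is_subgroup V -> derived k (V `&` H) `<=` H.
  move=> sV; apply: subset_trans (derived_sub k (is_subgroupI sV sH)) _.
  by move=> x [].
split; last 2 first.
- by move=> x [].
- move=> x g [Hx [V [sV oV VW cV]]] Hg; split; first exact: is_subgroupJ.
  exists (conj_set V g^-1 `&` W); split.
  + by apply: is_subgroupI => //; exact: is_subgroup_conj.
  + apply: openI => //; apply: open_subgroup; first exact: is_subgroup_conj.
    by apply: nbhs_conj; exact: open_subgroup_nbhs.
  + by move=> y [].
  + move=> s ds; rewrite -(conjgKV g s) -conjRg; apply: nNJ => //; apply: cV.
    have := derived_conjJ g^-1 ds; apply: derivedS => z [[]].
    rewrite /conj_set /= invgK conjgK => Vz _ Hz; split=> //.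
    by rewrite -(conjgK g z); apply: is_subgroupJ => //; exact: is_subgroupV.
split.
  split; first exact: is_subgroup1.
  exists W; split=> // s _; rewrite comm1g; exact: is_subgroup1.
move=> x y [Hx [Vx [sVx oVx VxW cx]]] [Hy [Vy [sVy oVy VyW cy]]].
split; first exact: sH.2.
exists (Vx `&` Vy); split.
- exact: is_subgroupI.
- exact: openI.
- by move=> z [/VxW].
pose S := derived k (Vx `&` Vy `&` H).
have SH : S `<=` H by apply: dH; exact: is_subgroupI.
suff [_ cxy] : centralizer_mod H N S (x * y^-1) by exact: cxy.
apply: (is_subgroup_centralizer_mod sH nN SH).2; split=> // s Ss.
- by apply: cx; move: s Ss; apply: derivedS => z [[]].
- by apply: cy; move: s Ss; apply: derivedS => z [[]].
Qed.

(** Since the local centralizer [D] is dense in its closure and [L] is open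
    there, finitely many translates of [W] by elements of [D `&` L] cover the
    compact set [K], and finitely many elements of [D] share one [V]. *)
Lemma local_centralizer_uniform k W H N K L :
  is_subgroup H -> normal_in H N -> is_subgroup W -> open W -> closed H ->
  is_subgroup L -> L `<=` closure (local_centralizer k W H N) ->
  relatively_open (closure (local_centralizer k W H N)) L ->
  compact K -> K `<=` L ->
  exists V, [/\ is_subgroup V, open V & forall x, K x ->
    exists d, [/\ L d, W (d^-1 * x) &
      forall s, derived k (V `&` H) s -> N [~ d, s]]].
Proof.
move=> sH nN sW oW cH sL LD [A nA AL] cK KL.
have sD := closure_normal (local_centralizer_normal k sH nN sW oW) cH.
set D := local_centralizer k W H N in LD AL sD *.
pose F := filter_from [set V | is_subgroup V /\ open V]
  (fun V => [set V' : set G | V' `<=` V]).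
have FF : Filter F.
  apply: filter_from_filter; first by exists setT; split=> //; exact: openT.
  move=> V V' [sV oV] [sV' oV']; exists (V `&` V').
    by split; [exact: is_subgroupI|exact: openI].
  by move=> V'' /= VV; split=> x /VV[].
pose P (V : set G) x := exists d, [/\ L d, W (d^-1 * x) &
      forall s, derived k (V `&` H) s -> N [~ d, s]].
have /compact_near_coveringP/(_ _ F P FF) := cK.
case=> [x Kx|V [sV oV] VP]; last first.
  by exists V; split=> // x Kx; exact: (VP V).
have nW := open_subgroup_nbhs oW sW.
have [d [Dd [/= Ad Wd]]] := LD _ (KL _ Kx) _ (nbhs_translate x (filterI nA nW)).
have Ld : L d.
  apply: (@is_subgroup_mull _ _ x^-1) => //.
    by apply: is_subgroupV => //; exact: KL.
  apply: AL; split=> //; have [sD' _ _] := sD.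
  apply: (is_subgroupM sD'); last exact: subset_closure.
  by apply: (is_subgroupV sD'); apply: LD; exact: KL.
have [_ [V [sV oV VW cV]]] := Dd.
exists ([set x' | W (x^-1 * x')], [set V' | V' `<=` V]).
  split; first exact: nbhs_translate.
  by exists V.
move=> [x' V'] /= [Wx' V'V]; exists d; split=> //.
  have -> : d^-1 * x' = (x^-1 * d)^-1 * (x^-1 * x').
    by rewrite invgM invgK !mulgA mulgK.
  by apply: is_subgroupM => //; exact: is_subgroupV.
move=> s ds; apply: cV; move: s ds; apply: derivedS => z [V'z Hz].
by split=> //; exact: V'V.
Qed.

(** The product [M] of [N `&` L] and the closure [C] of [derived k (V `&` L)],
    for a small enough [V], is normal in [L]: the generators of [L] either
    lie in [W], which normalizes [V], or commute with [C] modulo [N]. Hence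
    [L] has open subgroups of derived length [k] modulo [M], and [M] is abelian
    modulo [N]. *)
Lemma tame_local_centralizer k W H N L m c :
  is_subgroup H -> closed H -> normal_in H N -> closed N ->
  is_subgroup W -> open W -> compact W ->
  derived k.+1 (W `&` H) `<=` N -> tame m N ->
  (forall K M V, is_subgroup K -> closed K -> normal_in K M -> closed M ->
    is_subgroup V -> open V -> compact V ->
    derived k (V `&` K) `<=` M -> tame m.+1 M -> tame (m.+1 + c) K) ->
  is_subgroup L -> L `<=` closure (local_centralizer k W H N) ->
  relatively_open (closure (local_centralizer k W H N)) L ->
  compactly_generated_set L -> tame (m.+1 + c) L.
Proof.
move=> sH cH nN cN sW oW cW dN tN IH sL LD oL [K cK LK].
have KL : K `<=` L by rewrite LK; exact: sub_generated.
have [sD' D'H _] := closure_normal (local_centralizer_normal k sH nN sW oW) cH.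
have LH : L `<=` H by exact: subset_trans LD D'H.
have cL : closed L by apply: relatively_open_closed oL _ _ => //; exact: closed_closure.
have [V0 [sV0 oV0 KV0]] := local_centralizer_uniform sH nN sW oW cH sL LD oL cK KL.
have [V [sV oV VV0 VW]] := open_core sW cW (is_subgroupI sV0 sW) (openI oV0 oW).
have cV : compact V.
  apply: (subclosed_compact _ cW); first exact: open_subgroup_closed.
  by move=> x /VV0[].
have sVL := is_subgroupI sV sL.
pose S := derived k (V `&` L); pose C := closure S.
have sS : is_subgroup S by exact: is_subgroup_derived.
have sC : is_subgroup C by exact: is_subgroup_closure.
have SVL : S `<=` V `&` L by exact: derived_sub.
have CVL : C `<=` V `&` L.
  have cVL : closed (V `&` L) by apply: closedI => //; exact: open_subgroup_closed.
  by rewrite [X in _ `<=` X](closure_id _).1//; exact: closureS.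
have CL : C `<=` L by move=> x /CVL[].
have cC : compact C.
  apply: (subclosed_compact _ cV); first exact: closed_closure.
  by move=> x /CVL[].
pose N1 := N `&` L.
have nN1 : normal_in L N1 by exact: normal_in_subI nN.
have [sN1 N1L nN1J] := nN1.
have cN1 : closed N1 by exact: closedI.
pose M := product_set N1 C.
have sM : is_subgroup M by exact: normal_in_product nN1 sC CL.
have N1M : N1 `<=` M.
  by move=> x Nx; exists x => //; exists 1; [exact: is_subgroup1|rewrite mulg1].
have CM : C `<=` M.
  by move=> x Cx; exists 1; [exact: is_subgroup1|exists x => //; rewrite mul1g].
have ML : M `<=` L.
  by move=> _ [x /N1L Lx [y /CL Ly ->]]; exact: is_subgroupM.
have cM : closed M by exact: closed_mul_compact.
have CC x y : C x -> C y -> N1 [~ x, y].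
  apply: commg_closure_sub => // {}x {}y Sx Sy; split.
    apply: dN; have := derived_comm Sx Sy; apply: derivedS => z [Vz Lz].
    by split; [case: (VV0 _ Vz)|exact: LH].
  by have [[_ Lx] [_ Ly]] := (SVL _ Sx, SVL _ Sy); exact: is_subgroupR.
have MM x y : M x -> M y -> N1 [~ x, y].
  have CZ z : C z -> centralizer_mod L N1 M z.
    move=> Cz; split=> [|w Mw]; first exact: CL.
    rewrite -invgR; apply: is_subgroupV => //.
    have [_] : centralizer_mod L N1 C w; last exact.
    have sZ := is_subgroup_centralizer_mod sL nN1 CL.
    case: Mw => n Nn [c0 Cc0 ->]; apply: is_subgroupM => //.
      split=> [|s Cs]; first exact: N1L.
      by apply: (normal_inR nN1) => //; exact: CL.
    by split=> [|s Cs]; [exact: CL|exact: CC].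
  move=> Mx My; have [_] : centralizer_mod L N1 M x; last exact.
  have sZ := is_subgroup_centralizer_mod sL nN1 ML.
  case: Mx => n Nn [c0 Cc0 ->]; apply: is_subgroupM => //; last exact: CZ.
  split=> [|s Ms]; first exact: N1L.
  by apply: (normal_inR nN1) => //; exact: ML.
pose Z := [set g | [/\ L g, forall z, M z -> M (z ^ g) &
  forall z, M z -> M (z ^ g^-1)]].
have sZ : is_subgroup Z.
  split; first by split; [exact: is_subgroup1| |] => z; rewrite ?invg1 conjg1.
  move=> x y [Lx x1 x2] [Ly y1 y2]; split=> [|z Mz|z Mz].
  - exact: sL.2.
  - by rewrite conjgM; apply: y2; exact: x1.
  - by rewrite invgM invgK conjgM; apply: x2; exact: y1.
have CZ g : L g -> (forall z, C z -> M (z ^ g)) -> forall z, M z -> M (z ^ g).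
  move=> Lg Cg _ [x Nx [y Cy ->]]; rewrite conjMg; apply: is_subgroupM => //.
    by apply: N1M; exact: nN1J.
  exact: Cg.
have centZ d : centralizer_mod L N1 C d -> Z d.
  move=> Zd; have sCd := is_subgroup_centralizer_mod sL nN1 CL.
  have cM' g : centralizer_mod L N1 C g -> forall z, M z -> M (z ^ g).
    move=> [Lg Cg]; apply: CZ => // z Cz.
    have -> : z ^ g = z * [~ g, z]^-1 by rewrite invgR commgEl mulVKg.
    apply: is_subgroupM => //; first exact: CM.
    by apply: N1M; apply: is_subgroupV => //; exact: Cg.
  split; [by case: Zd|exact: cM'|apply: cM'; exact: is_subgroupV].
have WZ w : W w -> L w -> Z w.
  have WM g : W g -> L g -> forall z, M z -> M (z ^ g).
    move=> Wg Lg; apply: CZ => // z Cz; apply: CM; move: z Cz.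
    apply: (@closure_image_sub _ S C (fun z => z ^ g)).
    - exact: conjg_continuous.
    - exact: closed_closure.
    - move=> z Sz; apply: subset_closure; have := derived_conjJ g Sz.
      apply: derivedS => y [Vy Ly]; rewrite -(conjgKV g y).
      by split; [exact: VW|exact: is_subgroupJ].
  move=> Ww Lw; split=> //; first exact: WM.
  by apply: WM; exact: is_subgroupV.
have LZ : L `<=` Z.
  rewrite LK; apply: generated_sub => // x Kx.
  have [d [Ld Wd dN0]] := KV0 _ Kx.
  rewrite -(mulVKg d x); apply: is_subgroupM => //; last first.
    apply: WZ => //; apply: is_subgroupM => //; [exact: is_subgroupV|exact: KL].
  apply: centZ; split=> //.
  apply: (@closure_image_sub _ S N1 (fun s => [~ d, s])) => //.
    by move=> z; apply: commg_cvg; [exact: cst_cvg|exact: id_cvg].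
  move=> s Ss; have [_ Ls] := SVL _ Ss; split; last exact: is_subgroupR.
  apply: dN0; move: s Ss {Ls}; apply: derivedS => y [/VV0[V0y _] Ly].
  by split=> //; exact: LH.
have nM : normal_in L M.
  by split=> // x g Mx /LZ[_ + _]; exact.
have tN1 : tame m N1.
  apply: (tame_subgroup sN1 cN1 _ tN); exact: subIsetl.
have nMN1 : normal_in M N1 by split=> // x g Nx /ML; exact: nN1J.
have tM : tame m.+1 M by exact: (tame_abelian sM cM nMN1 cN1 MM cC erefl tN1).
apply: IH nM cM sV oV cV _ tM => //.
by move=> x Sx; apply: CM; exact: subset_closure.
Qed.

(** Induction on the derived length [k]. The closure of the local centralizer
    contains [derived k (W `&` H)], so the induction hypothesis climbs from it
    to [H]; and [tame_local_centralizer] applies the same hypothesis to its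
    compactly generated open subgroups. The bound grows like [2 ^ k]. *)
Lemma tame_of_derived_sub k : exists c, forall H N W m,
  is_subgroup H -> closed H -> normal_in H N -> closed N ->
  is_subgroup W -> open W -> compact W ->
  derived k (W `&` H) `<=` N -> tame m N -> tame (m + c) H.
Proof.
elim: k => [|k [c IH]].
  exists 1%N => H N W m sH cH nN cN sW oW cW dN tN.
  rewrite addn1; apply: (tame_open sH cH nN _ tN).
  by exists W => //; exact: open_subgroup_nbhs.
exists (c.+2 + c)%N => H N W m sH cH nN cN sW oW cW dN tN.
have nD := closure_normal (local_centralizer_normal k sH nN sW oW) cH.
rewrite addnA.
apply: (IH _ _ _ _ sH cH nD _ sW oW cW) => //; first exact: closed_closure.
  move=> s ds; apply: subset_closure; split.
    by have [] := derived_sub k (is_subgroupI sW sH) ds.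
  exists W; split=> // t dt; apply: dN; exact: derived_comm.
rewrite addnS; apply: tame_union; [by case: nD|exact: closed_closure|].
move=> L sL LD oL cL.
rewrite -addSnnS.
apply: (tame_local_centralizer sH cH nN cN sW oW cW dN tN _ sL LD oL cL).
move=> K M V sK cK nM cM sV oV cV dM; exact: IH dM.
Qed.

End Tame.

(** * Finite rank *)

Section Rank.
Local Open Scope group_scope.

Lemma residual_in_sub (G : topGroupType) (K : set G) :
  is_subgroup K -> residual_in K `<=` K.
Proof.
move=> sK x; apply; split; first exact: normal_in_refl.
by exists setT; [exact: filterT|move=> z []].
Qed.

(** The rank equation unfolded [m] times, with all compactly generated
    subgroups in place of the relatively open ones: in this form it visibly
    passes to subgroups of [H]. *)
Fixpoint rank_le (G : topGroupType) m (H : set G) : Prop :=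
  if m is m'.+1 then
    forall K, is_subgroup K -> K `<=` H -> compactly_generated_set K ->
      rank_le m' (residual_in K)
  else H `<=` [set 1].

Lemma rank_leS (G : topGroupType) m (H K : set G) :
  K `<=` H -> rank_le m H -> rank_le m K.
Proof.
case: m => [|m] KH /=; first exact: subset_trans.
by move=> rH L sL LK; apply: rH => //; exact: subset_trans KH.
Qed.

(** If [H] is abelian modulo a closed [N], then every [N V] with [V] open is an
    open normal subgroup, and these intersect in [N]. *)
Lemma residual_in_abelian (G : topGroupType) (H N K : set G) :
  has_small_open_subgroups G -> is_subgroup H -> normal_in H N -> closed N ->
  (forall x y, H x -> H y -> N [~ x, y]) ->
  is_subgroup K -> K `<=` H -> residual_in K `<=` N.
Proof.
move=> sG sH nN cN abH sK KH x Rx; have [sN NH _] := nN.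
apply: contrapT => Nx.
have nA : nbhs (1 : G) [set v | ~ N (x * v^-1)].
  have ct : {for (1 : G), continuous (fun v : G => x * v^-1)}.
    by apply: mulg_cvg; [exact: cst_cvg|exact: invg_cvg (@id_cvg _ _)].
  apply: (ct (~` N)); rewrite /= invg1 mulg1.
  by apply: open_nbhs_nbhs; split=> //; exact: closed_openC.
have [V [sV oV VA]] := sG _ nA.
have sVH := is_subgroupI sV sH.
have sNV : is_subgroup (product_set N (V `&` H)).
  by apply: (normal_in_product sH nN sVH) => z [].
have : (product_set N (V `&` H) `&` K) x.
  apply: Rx; split; first split.
  - exact: is_subgroupI.
  - by move=> z [].
  - move=> z g [NVz Kz] Kg; split; last exact: is_subgroupJ.
    have -> : z ^ g = z * [~ z, g] by rewrite commgEl mulVKg.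
    apply: is_subgroupM => //; exists [~ z, g].
      by apply: abH; exact: KH.
    by exists 1; [exact: is_subgroup1|rewrite mulg1].
  - exists V; first exact: open_subgroup_nbhs.
    move=> z [Vz Kz]; split=> //; exists 1; first exact: is_subgroup1.
    by exists z; [split=> //; exact: KH|rewrite mul1g].
move=> [[n Nn [v [Vv _] xE]] _]; apply: (VA _ Vv).
by rewrite xE mulgK.
Qed.

(** Each construction adds at most one to the rank. For an open normal [N], and
    for a closed [N] with abelian quotient, the residuals of the subgroups of
    [H] lie in [N]; for a union, a compactly generated subgroup of [H] is
    enlarged to a relatively open one. *)
Lemma tame_rank_le (G : topGroupType) (U : set G) m (H : set G) :
  has_small_open_subgroups G -> is_subgroup U -> open U -> compact U ->
  tame m H -> rank_le m H.
Proof.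
move=> sG sU oU cU; elim=> {m H} [|m H K _ _ KH _ rH|m H N sH _ nN [A nA AN] _ rN
  |m H N C sH _ nN cN abH _ _ _ rN|m H sH cH _ IH] //=.
- exact: rank_leS rH.
- move=> K sK KH _; apply: rank_leS rN => x Rx.
  have [] // : (N `&` K) x.
  apply: Rx; split; first exact: normal_in_subI nN.
  exists A => // y [Ay Ky]; split=> //.
  by apply: AN; split=> //; exact: KH.
- move=> K sK KH _; apply: rank_leS rN.
  exact: (residual_in_abelian sG sH nN cN abH).
- move=> K sK KH [C cC KE].
  pose L := generated (C `|` (U `&` H)).
  have sL : is_subgroup L by exact: is_subgroup_generated.
  have KL : K `<=` L by rewrite KE; apply: generatedS => x; left.
  apply: (@rank_leS _ _ L).
    by apply: subset_trans KL; exact: residual_in_sub.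
  apply: IH => //.
  + apply: generated_sub => // x [Cx|[]//].
    by apply: KH; rewrite KE; exact: sub_generated.
  + exists U; first exact: open_subgroup_nbhs.
    by move=> x UHx; apply: sub_generated; right.
  + exists (C `|` (U `&` H)) => //; apply: compactU => //.
    apply: (subclosed_compact _ cU); last by move=> x [].
    by apply: closedI => //; exact: open_subgroup_closed.
Qed.

(** Adjoin the terms of a dense sequence, one at a time, to a compact open
    subgroup. *)
Lemma compactly_generated_exhaustion (T : topGroupType) (V : set T) :
  is_subgroup V -> open V -> compact V -> @second_countable T ->
  exists O : nat -> subgroup T, increasing_open_union O /\
    forall i, compactly_generated (subgrp (O i)).
Proof.
move=> sV oV cV [B /countable_injP[e eI] [oB bB]].
pose x i := xget (1 : T) [set z | exists b, [/\ B b, e b = i & b z]].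
pose K i := V `|` x @` `I_i.
have sK i : is_subgroup (generated (K i)) by exact: is_subgroup_generated.
exists (fun i => subgroup_of (sK i)); split; first split.
- move=> i; apply: open_subgroup => //=.
  apply: filterS (open_subgroup_nbhs oV sV) => z Vz.
  by apply: sub_generated; left.
- move=> i; apply: generatedS => z [Vz|[j /= ji <-]]; first by left.
  by right; exists j => //=; exact: ltnW.
- apply/seteqP; split=> // z _.
  have [b [Bb bz] bV] := bB _ _ (nbhs_translate z (open_subgroup_nbhs oV sV)).
  exists (e b).+1 => //=.
  have bx : b (x (e b)).
    have : [set z | exists b', [/\ B b', e b' = e b & b' z]] (x (e b)).
      by apply: (@xgetPex _ 1); exists z, b.
    by move=> [b' [Bb' /eI ->//]]; exact: mem_set.
  have Vzx := bV _ bx; rewrite /= in Vzx.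
  have -> : z = x (e b) * (z^-1 * x (e b))^-1 by rewrite invgM invgK mulVKg.
  apply: (sK _).2; apply: sub_generated; last by left.
  by right; exists (e b) => //=.
- move=> i; apply/(embedding_compactly_generated (embedding_val _)).
  exists (K i) => //; apply: compactU => //.
  by apply: finite_compact; apply: finite_image; exact: finite_II.
Qed.

Lemma preimage_compact_open (T G : topGroupType) (f : T -> G) (H U : set G) :
  embedding_onto f H -> closed H -> is_subgroup U -> open U -> compact U ->
  [/\ is_subgroup (f @^-1` U), open (f @^-1` U) & compact (f @^-1` U)].
Proof.
move=> fH cH sU oU cU; split.
- exact: (preimage_subgroup fH).
- exact: (embedding_preimage_open fH).
- have -> : f @^-1` U = f @^-1` (U `&` H).
    apply/seteqP; split=> x; last by case.
    by move=> Ux; split=> //; exact: (embedding_in fH).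
  apply: (embedding_compact fH); first by move=> x [].
  apply: (subclosed_compact _ cU); last by move=> x [].
  by apply: closedI => //; exact: open_subgroup_closed.
Qed.

Lemma closed_residual_set (T : topGroupType) : closed (@residual_set T).
Proof.
apply: closed_bigI => N [oN _].
by apply: open_subgroup_closed => //; exact: subgroup_is_subgroup.
Qed.

(** The index is shifted by one because the trivial group has rank [1]. *)
Lemma has_rank_of_rank_le (G : topGroupType) (U : set G) m
    (T : topGroupType) (f : T -> G) (H : set G) :
  tdlcsc G -> is_subgroup U -> open U -> compact U ->
  embedding_onto f H -> closed H -> rank_le m H ->
  exists2 b, has_rank T b & ord_le b (ord_nat m.+1).
Proof.
move=> tG sU oU cU; elim: m T f H => [|m IH] T f H fH cH rH.
  exists (ord_nat 1); last exact: ord_le_refl.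
  apply: has_rank_trivial; last by split; exact: ord_le_refl.
  apply/seteqP; split=> // x _; have [_ fI _ _ _] := fH.
  apply: fI; rewrite (embedding1 fH); apply: rH; exact: (embedding_in fH).
have [T1|T1] := pselect ([set: T] = [set 1]).
  exists (ord_nat 1); last by apply: ord_le_succ; exact: ord_le0.
  by apply: has_rank_trivial => //; split; exact: ord_le_refl.
have [sV oV cV] := preimage_compact_open fH cH sU oU cU.
have [_ _ scT _] := embedding_tdlcsc fH cH tG.
have [K [uK gK]] := compactly_generated_exhaustion sV oV cV scT.
have [oK _ _] := uK.
have /choice[b rb] : forall i, exists b,
    has_rank (subgrp (residual (subgrp (K i)))) b /\ ord_le b (ord_nat m.+1).
  move=> i.
  have eK := embedding_comp (embedding_val (K i)) fH.
  have eR := embedding_comp (embedding_val (residual (subgrp (K i)))) eK.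
  have cK : closed (f @` K i).
    apply: (embedding_image_closed fH) => //; apply: open_subgroup_closed => //.
    exact: subgroup_is_subgroup.
  have cR := embedding_image_closed eK cK (@closed_residual_set (subgrp (K i))).
  have [|b ? ?] := IH _ _ _ eR cR; last by exists b.
  rewrite (embedding_residual eK); apply: rH.
  - exact: embedding_range_subgroup eK.
  - exact: (embedding_image_sub fH).
  - exact: (embedding_compactly_generated eK).1 (gK i).
exists (ord_succ (ord_sup b)).
  apply: (has_rank_union T1 uK gK (fun i => (rb i).1)).
  by split; exact: ord_le_refl.
by apply: ord_le_succ; apply: ord_sup_le => i; case: (rb i).
Qed.

End Rank.

(** * Quotient groups *)

Section QuotientGroup.
Variables (T : topGroupType) (N : subgroup T).
Hypothesis nN : normal N.
Local Open Scope group_scope.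
Local Open Scope quotient_scope.

Let sN : is_subgroup (N : set T) := subgroup_is_subgroup N.

Definition coset_rel (x y : T) : bool := `[< (N : set T) (x^-1 * y) >].

Lemma coset_rel_refl : reflexive coset_rel.
Proof. by move=> x; apply/asboolP; rewrite mulVg; exact: is_subgroup1. Qed.

Lemma coset_rel_sym : symmetric coset_rel.
Proof.
move=> x y; apply/idP/idP => /asboolP Nxy; apply/asboolP.
  by rewrite -[y^-1 * x]invgK invgM invgK; exact: is_subgroupV.
by rewrite -[x^-1 * y]invgK invgM invgK; exact: is_subgroupV.
Qed.

Lemma coset_rel_trans : transitive coset_rel.
Proof.
move=> y x z /asboolP Nxy /asboolP Nyz; apply/asboolP.
have -> : x^-1 * z = (x^-1 * y) * (y^-1 * z) by rewrite mulgA mulgK.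
exact: is_subgroupM.
Qed.

Canonical coset_equiv :=
  EquivRel coset_rel coset_rel_refl coset_rel_sym coset_rel_trans.

(** The proof of normality is an argument so that the group structure can be
    attached to the type. *)
Definition quotient_group (_ : normal N) : Type :=
  quotient_topology {eq_quot coset_equiv}.

Local Notation Q := (quotient_group nN).

HB.instance Definition _ := Choice.copy Q (quotient_topology {eq_quot coset_equiv}).
HB.instance Definition _ := Topological.copy Q (quotient_topology {eq_quot coset_equiv}).

Definition quotient_proj (x : T) : Q := \pi_({eq_quot coset_equiv}) x.
Local Notation p := quotient_proj.

Lemma quotient_projP x y : p x = p y <-> (N : set T) (x^-1 * y).
Proof.
split=> [/eqmodP/asboolP//|Nxy]; apply/eqmodP; exact/asboolP.
Qed.

Definition quotient_repr (q : Q) : T := repr (q : {eq_quot coset_equiv}).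

Lemma quotient_reprK q : p (quotient_repr q) = q.
Proof. exact: reprK. Qed.

Definition quotient_one : Q := p 1.
Definition quotient_mul (x y : Q) : Q := p (quotient_repr x * quotient_repr y).
Definition quotient_inv (x : Q) : Q := p (quotient_repr x)^-1.

Lemma quotient_mulE x y : quotient_mul (p x) (p y) = p (x * y).
Proof.
apply/quotient_projP.
have /quotient_projP Nx := quotient_reprK (p x).
have /quotient_projP Ny := quotient_reprK (p y).
set x' := quotient_repr _ in Nx *; set y' := quotient_repr _ in Ny *.
have -> : (x' * y')^-1 * (x * y) = (x'^-1 * x) ^ y' * (y'^-1 * y).
  by rewrite !conjgE !invgM !mulgA mulgK.
by apply: is_subgroupM => //; exact: nN.
Qed.

Lemma quotient_invE x : quotient_inv (p x) = p x^-1.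
Proof.
apply/quotient_projP.
have /quotient_projP Nx := quotient_reprK (p x).
set x' := quotient_repr _ in Nx *.
have -> : x'^-1^-1 * x^-1 = ((x'^-1 * x) ^ x'^-1)^-1.
  by rewrite !conjgE !invgM !invgK !mulgA mulgK.
by apply: is_subgroupV => //; exact: nN.
Qed.

Lemma quotient_mulA : associative quotient_mul.
Proof.
move=> x y z; rewrite -(quotient_reprK x) -(quotient_reprK y) -(quotient_reprK z).
by rewrite !quotient_mulE mulgA.
Qed.

Lemma quotient_mul1 : left_id quotient_one quotient_mul.
Proof. by move=> x; rewrite -(quotient_reprK x) quotient_mulE mul1g. Qed.

Lemma quotient_mulr1 : right_id quotient_one quotient_mul.
Proof. by move=> x; rewrite -(quotient_reprK x) quotient_mulE mulg1. Qed.

Lemma quotient_mulV : left_inverse quotient_one quotient_inv quotient_mul.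
Proof.
by move=> x; rewrite -(quotient_reprK x) quotient_invE quotient_mulE mulVg.
Qed.

Lemma quotient_mulrV : right_inverse quotient_one quotient_inv quotient_mul.
Proof.
by move=> x; rewrite -(quotient_reprK x) quotient_invE quotient_mulE mulgV.
Qed.

HB.instance Definition _ := isGroup.Build Q
  quotient_mulA quotient_mul1 quotient_mulr1 quotient_mulV quotient_mulrV.

Lemma quotient_projM : {morph p : x y / x * y}.
Proof. by move=> x y; rewrite -quotient_mulE. Qed.

Lemma quotient_proj_surj q : exists x, p x = q.
Proof. by exists (quotient_repr q); exact: quotient_reprK. Qed.

Lemma quotient_openE (V : set Q) : open (p @^-1` V) <-> open V.
Proof. by []. Qed.

Lemma quotient_proj_continuous : continuous p.
Proof. by apply/continuousP => A. Qed.

Lemma quotient_proj_image (A : set T) :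
  p @^-1` (p @` A) = [set x | exists2 a, A a & (N : set T) (a^-1 * x)].
Proof.
apply/seteqP; split=> [x [a Aa /quotient_projP Nax]|x [a Aa /quotient_projP Nax]];
  by exists a.
Qed.

(** The saturation of [A] is the union of its translates by [N]. *)
Lemma quotient_proj_open (A : set T) : open A -> open (p @` A).
Proof.
move=> oA; change (open (p @^-1` (p @` A))); rewrite quotient_proj_image.
have -> : [set x | exists2 a, A a & (N : set T) (a^-1 * x)] =
    \bigcup_(n in (N : set T)) [set x | A (x * n^-1)].
  apply/seteqP; split=> [x [a Aa Nax]|x [n Nn /= Axn]].
    by exists (a^-1 * x) => //=; rewrite invgM invgK mulVKg.
  by exists (x * n^-1) => //; rewrite invgM invgK mulgVK.
apply: bigcup_open => n _; apply: open_comp => // x _.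
change {for x, continuous (fun y : T => y * n^-1)}.
by apply: mulg_cvg; [exact: id_cvg|exact: cst_cvg].
Qed.

Lemma quotient_nbhs (x : T) (A : set T) : nbhs x A -> nbhs (p x) (p @` A).
Proof.
rewrite nbhsE => -[D [oD Dx] DA].
apply: (@filterS _ _ _ (p @` D)); first exact: image_subset.
by apply: open_nbhs_nbhs; split; [exact: quotient_proj_open|exists x].
Qed.

Lemma quotient_mulg_continuous : continuous (fun u : Q * Q => u.1 * u.2).
Proof.
move=> [q r] A; have [x <-] := quotient_proj_surj q.
have [y <-] := quotient_proj_surj r; rewrite /= -quotient_projM => nA.
have ct : {for (x, y), continuous (fun u : T * T => p (u.1 * u.2))}.
  apply: (@continuous_comp _ _ _ (fun u : T * T => u.1 * u.2) p).
    exact: mulg_continuous.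
  exact: quotient_proj_continuous.
have [[B C] /= [nB nC] BC] := ct _ nA.
exists (p @` B, p @` C); first by split; exact: quotient_nbhs.
move=> [_ _] [/= [b Bb <-] [c Cc <-]]; rewrite -quotient_projM.
exact: (BC (b, c)).
Qed.

Lemma quotient_invg_continuous : continuous (fun u : Q => u^-1).
Proof.
move=> q A; have [x <-] := quotient_proj_surj q.
have pV y : (p y)^-1 = p y^-1 by rewrite -quotient_invE.
rewrite pV => nA.
have ct : {for x, continuous (fun u : T => p u^-1)}.
  apply: (@continuous_comp _ _ _ (fun u : T => u^-1) p).
    exact: invg_continuous.
  exact: quotient_proj_continuous.
apply: filterS (quotient_nbhs (ct _ nA)) => _ [y Ay <-].
by rewrite /= pV.
Qed.

HB.instance Definition _ := PreTopologicalGroup_isTopologicalGroup.Build Q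
  quotient_mulg_continuous quotient_invg_continuous.

Lemma quotient_proj_quotient_map : quotient_map N (p : T -> Q).
Proof.
split=> //; first exact: quotient_projM.
  by apply/seteqP; split=> // q _; have [x <-] := quotient_proj_surj q; exists x.
apply/seteqP; split=> [x /esym/quotient_projP|x Nx].
  by rewrite invg1 mul1g.
by apply/esym/quotient_projP; rewrite invg1 mul1g.
Qed.

Lemma quotient_second_countable : @second_countable T -> @second_countable Q.
Proof.
move=> [B cB [oB bB]]; exists ((fun b => p @` b) @` B).
  exact: sub_countable (card_image_le _ _) cB.
split=> [_ [b /oB ob <-]|q A]; first exact: quotient_proj_open.
have [x <-] := quotient_proj_surj q => /quotient_proj_continuous/bB[b [Bb bx] bA].
exists (p @` b); first by split; [exists b|exists x].
by move=> _ [y /bA Ay <-].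
Qed.

End QuotientGroup.

(** * Elementary quotients and extensions *)

Section Elementary.
Local Open Scope group_scope.

(** An isomorphism exhibits its target as the quotient by the trivial
    subgroup. *)
Lemma elementary_iso (S T G : topGroupType) (h : S -> G) (f : T -> G)
    (K : set G) :
  embedding_onto h K -> embedding_onto f K -> hausdorff_space S ->
  elementary S -> elementary T.
Proof.
move=> hK fK hS eS.
have [hM hI hc ho hR] := hK; have [fM fI fc fo fR] := fK.
have /choice[p pE] : forall s, exists t, f t = h s.
  by move=> s; apply: (embedding_onto_ex fK); exact: (embedding_in hK).
have s1 := @is_subgroup_set1 S.
apply: (@elementary_quotient S (subgroup_of s1) T p eS).
- apply: accessible_closed_set1; exact: hausdorff_accessible.
- by move=> x g /= ->; rewrite conj1g.
- split.
  + by move=> x y; apply: fI; rewrite fM !pE hM.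
  + apply/seteqP; split=> // t _.
    have [s st] := embedding_onto_ex hK (embedding_in fK t).
    by exists s => //; apply: fI; rewrite pE.
  + apply/seteqP; split=> [s /= ps|s /= ->].
      by apply: hI; rewrite -pE ps (embedding1 fK) (embedding1 hK).
    by apply: fI; rewrite pE (embedding1 fK) (embedding1 hK).
  + move=> V; split=> [/ho[B oB pB]|/fo[B oB ->]].
      have -> : V = f @^-1` B.
        apply/seteqP; split=> t; have [s st] := embedding_onto_ex hK (embedding_in fK t).
          have <- : p s = t by apply: fI; rewrite pE.
          move=> Vs; have : (p @^-1` V) s by [].
          by rewrite pB /= pE.
        have <- : p s = t by apply: fI; rewrite pE.
        by rewrite /= pE => Bs; have : (h @^-1` B) s by []; rewrite -pB.
      exact: (embedding_preimage_open fK).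
    have -> : p @^-1` (f @^-1` B) = h @^-1` B.
      by apply/funext => s; rewrite /preimage /= pE.
    exact: (embedding_preimage_open hK).
Qed.

Lemma elementary_extension_by (T : topGroupType) (N : subgroup T)
    (nN : normal N) :
  tdlcsc T -> closed N -> elementary (subgrp N) ->
  elementary (quotient_group nN) -> elementary T.
Proof.
move=> tT cN eN eQ.
exact: elementary_extension tT cN nN (quotient_proj_quotient_map nN) eN eQ.
Qed.

Lemma elementary_quotient_open (T : topGroupType) (N : subgroup T)
    (nN : normal N) :
  open N -> @second_countable T -> elementary (quotient_group nN).
Proof.
move=> oN scT.
have o1 (q : quotient_group nN) : open [set q].
  have [x <-] := quotient_proj_surj q.
  apply/quotient_openE.
  have -> : quotient_proj nN @^-1` [set quotient_proj nN x] =
      [set y | (N : set T) (x^-1 * y)].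
    by apply/seteqP; split=> y /=; [move/esym/quotient_projP|move/quotient_projP].
  apply: open_comp => // y _; exact: mulgl_continuous.
apply: elementary_discrete => //.
have [B cB [oB bB]] := quotient_second_countable nN scT.
have B1 q : B [set q].
  have [b [Bb bq] b1] := bB q _ (open_nbhs_nbhs (conj (o1 q) erefl)).
  by have <- : b = [set q] by apply/seteqP; split=> // _ ->.
have /countable_injP[e eI] := cB.
apply/countable_injP; exists (fun q => e [set q]) => q r _ _ /eI qr.
have : [set r] q by rewrite -qr; [|exact: mem_set..].
by [].
Qed.

(** If [T] is abelian modulo [N] then the subgroups [N V], for [V] an open
    subgroup, give clopen subgroups of the quotient that separate points. *)
Lemma profinite_quotient_abelian (T : topGroupType) (N : subgroup T)
    (nN : normal N) (C : set T) :
  has_small_open_subgroups T -> closed N ->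
  (forall x y, (N : set T) [~ x, y]) -> compact C ->
  [set: T] = product_set N C -> profinite (quotient_group nN).
Proof.
move=> sT cN abT cC TE.
have zQ : zero_dimensional (quotient_group nN).
  move=> q r qr.
  have [x xq] := quotient_proj_surj q; have [y yr] := quotient_proj_surj r.
  have Nyx : ~ (N : set T) (x^-1 * y).
    by move=> /(quotient_projP nN); rewrite xq yr => /eqP; exact/negP.
  have nA : nbhs (1 : T) [set v | ~ (N : set T) (v^-1 * (x^-1 * y))].
    have ct : {for (1 : T), continuous (fun v : T => v^-1 * (x^-1 * y))}.
      by apply: mulg_cvg; [exact: invg_cvg (@id_cvg _ _)|exact: cst_cvg].
    apply: (ct (~` (N : set T))); rewrite /= invg1 mul1g.
    by apply: open_nbhs_nbhs; split=> //; exact: closed_openC.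
  have [V [sV oV VA]] := sT _ nA.
  have sN := subgroup_is_subgroup N.
  have nTN : normal_in [set: T] (N : set T) by split=> // z g Nz _; apply: (nN z g Nz).
  pose P := product_set (N : set T) V.
  have sP : is_subgroup P by exact: (normal_in_product _ nTN sV).
  have oP : open P.
    apply: open_subgroup => //; apply: filterS (open_subgroup_nbhs oV sV) => v Vv.
    by exists 1; [exact: is_subgroup1|exists v; rewrite ?mul1g].
  pose D := [set z | P (x^-1 * z)].
  have DE : quotient_proj nN @^-1` (quotient_proj nN @` D) = D.
    rewrite quotient_proj_image; apply/seteqP; split=> z; last first.
      by move=> Dz; exists z => //; rewrite mulVg; exact: is_subgroup1.
    move=> [a Da Naz]; rewrite /D /= -(mulVKg a z) mulgA.
    apply: is_subgroupM => //; exists (a^-1 * z) => //.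
    by exists 1; [exact: is_subgroup1|rewrite mulg1].
  exists (quotient_proj nN @` D); split.
  - split.
      apply: quotient_proj_open; apply: open_comp => // z _.
      exact: mulgl_continuous.
    rewrite -[X in closed X]setCK; apply: open_closedC.
    change (open (~` (quotient_proj nN @^-1` (quotient_proj nN @` D)))).
    rewrite DE; apply: closed_openC.
    apply: preimage_closed; last exact: open_subgroup_closed.
    by move=> z _; exact: mulgl_continuous.
  - by exists x => //; rewrite /D /= mulVg; exact: is_subgroup1.
  - move=> rD; have : D y by rewrite -DE /= yr.
    move=> [n Nn [v Vv xyE]]; apply: (VA _ Vv).
    by rewrite xyE; apply: (nN n v Nn).
have cQ : compact [set: quotient_group nN].
  have -> : [set: quotient_group nN] = quotient_proj nN @` C.
    apply/seteqP; split=> // q _; have [x <-] := quotient_proj_surj q.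
    have : [set: T] x by [].
    rewrite TE => -[n Nn [c Cc ->]].
    exists c => //; apply/quotient_projP.
    rewrite mulgA -[c^-1 * n * c]mulgA; exact: (nN n c Nn).
  apply: continuous_compact => //; apply: continuous_subspaceT.
  exact: quotient_proj_continuous.
split=> //; last exact: zero_dimension_totally_disconnected.
rewrite open_hausdorff => q r /zQ[D [[oD cD] Dq Dr]].
exists (D, ~` D); rewrite ?inE //=.
by split=> //; [exact: closed_openC|rewrite setICr].
Qed.

End Elementary.

(** * Groups with a solvable open subgroup *)

Section TameElementary.
Local Open Scope group_scope.

Lemma tame_is_subgroup (G : topGroupType) m (H : set G) :
  tame m H -> is_subgroup H.
Proof. by case=> // {m H}; exact: is_subgroup_set1. Qed.

(** Each construction is an instance of a closure property of the class of
    elementary groups. *)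
Lemma tame_elementary (G : topGroupType) (U : set G) m (H : set G) :
  tdlcsc G -> has_small_open_subgroups G -> is_subgroup U -> open U ->
  compact U -> tame m H ->
  forall (T : topGroupType) (f : T -> G), embedding_onto f H -> elementary T.
Proof.
move=> tG sG sU oU cU; have [_ _ _ hG] := tG.
have ext (N H' : set G) (T : topGroupType) (f : T -> G) :
    embedding_onto f H' -> closed H' -> normal_in H' N -> closed N ->
    (forall (S : topGroupType) (h : S -> G), embedding_onto h N -> elementary S) ->
    (forall (N' : subgroup T) (nN' : normal N'), N' = f @^-1` N :> set T ->
      elementary (quotient_group nN')) -> elementary T.
  move=> fH cH nN cN eN eQ; have [sN NH _] := nN.
  pose N' := subgroup_of (preimage_subgroup fH sN).
  have nN' : normal N' by exact: (preimage_normal fH nN).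
  apply: (@elementary_extension_by _ _ nN'); last exact: eQ.
  - exact: (embedding_tdlcsc fH cH).
  - exact: (embedding_preimage_closed fH).
  - have := embedding_comp (embedding_val N') fH.
    by rewrite (embedding_preimageK fH NH); exact: eN.
elim=> {m H} [|m H K sK cK KH tH eH|m H N sH cH nN oN tN eN
  |m H N C sH cH nN cN abH cC HE tN eN|m H sH cH tK eK] T f fH.
- have T1 (x : T) : x = 1.
    have [_ fI _ _ _] := fH; apply: fI; rewrite (embedding1 fH).
    exact: (embedding_in fH).
  apply: elementary_discrete => [|x].
    have -> : [set: T] = [set 1] by apply/seteqP; split=> // x _; exact: T1.
    exact: countable1.
  have -> : [set x] = [set: T] by apply/seteqP; split=> // y _; rewrite (T1 y) (T1 x).
  exact: openT.
- have sH := tame_is_subgroup tH; have eH' := embedding_val (subgroup_of sH).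
  pose K' := subgroup_of (preimage_subgroup eH' sK).
  have eK' := embedding_comp (embedding_val K') eH'.
  rewrite (embedding_preimageK eH' KH) in eK'.
  apply: (elementary_iso eK' fH); first exact: (embedding_hausdorff eK').
  apply: (@elementary_subgroup _ K' (eH _ _ eH')).
  exact: (embedding_preimage_closed eH').
- have [sN NH _] := nN.
  have cN : closed N by exact: (relatively_open_closed sN NH oN cH sH).
  apply: (ext N H T f fH cH nN cN eN) => N' nN' N'E.
  apply: elementary_quotient_open; last by have [] := embedding_tdlcsc fH cH tG.
  apply: open_subgroup; first exact: subgroup_is_subgroup.
  by rewrite N'E; exact: (preimage_relatively_open fH oN).
- apply: (ext N H T f fH cH nN cN eN) => N' nN' N'E.
  have [sN NH _] := nN.
  have CH : C `<=` H.
    move=> x Cx; rewrite HE; exists 1; first exact: is_subgroup1.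
    by exists x => //; rewrite mul1g.
  apply: elementary_profinite; last first.
    by apply: quotient_second_countable; have [] := embedding_tdlcsc fH cH tG.
  apply: (@profinite_quotient_abelian _ _ nN' (f @^-1` C)).
  + exact: (embedding_small fH).
  + by rewrite N'E; exact: (embedding_preimage_closed fH).
  + move=> x y; rewrite N'E /= (embeddingR fH); apply: abH;
      exact: (embedding_in fH).
  + exact: (embedding_compact fH).
  + apply/seteqP; split=> // x _; have := embedding_in fH x.
    rewrite {1}HE => -[n Nn [c Cc xE]].
    have [n' n'E] := embedding_onto_ex fH (NH _ Nn).
    have [c' c'E] := embedding_onto_ex fH (CH _ Cc).
    exists n'; first by rewrite N'E /= n'E.
    exists c'; first by rewrite /= c'E.
    by have [fM fI _ _ _] := fH; apply: fI; rewrite fM n'E c'E.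
- have [sV oV cV] := preimage_compact_open fH cH sU oU cU.
  have tT := embedding_tdlcsc fH cH tG; have [_ _ scT _] := tT.
  have [K [uK gK]] := compactly_generated_exhaustion sV oV cV scT.
  apply: (elementary_union tT uK) => i; have [oK _ _] := uK.
  have fK := embedding_comp (embedding_val (K i)) fH.
  apply: (eK _ _ _ _ _ _ _ fK).
  + exact: (embedding_range_subgroup fK).
  + exact: (embedding_image_sub fH).
  + apply: (embedding_relatively_open fH); apply: open_subgroup_nbhs => //.
    exact: subgroup_is_subgroup.
  + exact: (embedding_compactly_generated fK).1 (gK i).
Qed.

(** [tame_of_derived_sub] for the whole group and the trivial [N]. Small open
    subgroups come from the compact group [U]. *)
Theorem elementary_of_solvable_open_subgroup (G : topGroupType) (U : subgroup G) k :
  tdlcsc G -> open U -> compact U -> derived k (U : set G) `<=` [set 1] ->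
  elementary G /\ ord_lt (decomposition_rank G) omega.
Proof.
move=> tG oU cU dU; have [tdG lcG scG hG] := tG.
have sU := subgroup_is_subgroup U.
have sG : has_small_open_subgroups G.
  have eU := embedding_val U.
  have tU := embedding_tdlcsc eU (compact_closed hG cU) tG.
  have cptU : compact [set: subgrp U].
    have -> : [set: subgrp U] = (val : subgrp U -> G) @^-1` U.
      by apply/seteqP; split=> // x _; exact: (embedding_in eU).
    exact: (embedding_compact eU).
  have sUU : has_small_open_subgroups (subgrp U).
    by case: tU => ? _ _ ?; exact: compact_small_open_subgroups.
  move=> A nA.
  have nA' : nbhs (1 : subgrp U) (val @^-1` A).
    by apply: (@subgrp_val_continuous _ U); rewrite (embedding1 eU).
  have [V [sV oV VA]] := sUU _ nA'.
  have sV' := embedding_subgroup eU sV.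
  exists (val @` V); split=> //; last by move=> _ [x Vx <-]; exact: VA.
  apply: open_subgroup => //.
  have [B nB BV] := embedding_relatively_open eU (open_subgroup_nbhs oV sV).
  by apply: filterS BV _; apply: filterI => //; exact: open_subgroup_nbhs.
have [c tame_c] := tame_of_derived_sub G k.
have s1 := @is_subgroup_set1 G.
have tGc : tame (0 + c) [set: G].
  apply: (tame_c [set: G] [set 1] U 0%N) => //.
  - by split=> // x g ->; rewrite conj1g.
  - by apply: accessible_closed_set1; exact: hausdorff_accessible.
  - by rewrite setIT.
  - exact: tame_trivial.
have eG := embedding_id G.
split; first exact: tame_elementary tG sG sU oU cU tGc G id eG.
have rG := tame_rank_le sG sU oU cU tGc.
have [b rb bc] := has_rank_of_rank_le tG sU oU cU eG closedT rG.
exists c.+1; apply: ord_le_trans bc.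
by case: (decomposition_rankE rb).
Qed.

End TameElementary.

(** * Solvability of the incidence group *)

Section IncidenceGroup.
Variables (n : nat) (d : Order.disp_t) (L : porderType d) (nL : n_bounded n L).
Variable P : topComNzRingType.
Local Open Scope ring_scope.
Import Order.TTheory GRing.Theory.

Let finL := n_bounded_locally_finite nL.
Local Notation M := (incidence_ring finL P).
Local Notation GLP := (GL finL P).
Implicit Types (a b c : M) (s t u : L) (j k : nat).

Definition itv_card s t : nat := #|` fset_set (poset_itv s t)|%fset.

Lemma in_itv s t u : (u \in fset_set (poset_itv s t)) = (s <= u <= t)%O.
Proof.
rewrite in_fset_set; last exact: finL.
by apply/idP/idP => [/set_mem|?]; [|apply/mem_set].
Qed.

Lemma poset_itv_refl s : poset_itv s s = [set s].
Proof.
apply/seteqP; split=> u /=; first by move=> /le_anti.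
by move=> ->; rewrite /poset_itv /= lexx.
Qed.

Lemma itv_card_refl s : itv_card s s = 1%N.
Proof. by rewrite /itv_card poset_itv_refl fset_set1 cardfs1. Qed.

Lemma itv_card_le s t : (itv_card s t <= n)%N.
Proof.
apply: geq_card_fset_set; apply: card_le_trans (nL s); apply: subset_card_le.
by move=> u /andP[su _] /=; rewrite su orbT.
Qed.

Lemma itv_card_ltl s t u : (s <= u)%O -> (u <= t)%O -> u != t ->
  (itv_card s u < itv_card s t)%N.
Proof.
move=> su ut nut; apply: fproper_ltn_card; rewrite fproperE; apply/andP; split.
  apply/fsubsetP => v; rewrite !in_itv => /andP[-> vu]; exact: le_trans vu ut.
apply/negP => /fsubsetP/(_ t); rewrite !in_itv lexx andbT (le_trans su ut).
move=> /(_ isT)/andP[_ tu]; move/negP: nut; apply; apply/eqP/le_anti.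
by rewrite ut tu.
Qed.

Lemma entry_mulE a b s t :
  entry (a * b) s t = \sum_(u <- fset_set (poset_itv s t)) entry a s u * entry b u t.
Proof. by apply: inc_mulE; [exact: finL|]. Qed.

(** The cardinality of an interval measures the distance of an entry from the
    diagonal. Level [1] is the condition of having ones on the diagonal, and
    level [n] leaves the identity alone. *)
Definition unipotent_level j : set M :=
  [set a | forall s t, (itv_card s t <= j)%N -> entry a s t = (s == t)%:R].

Lemma entry1 s t : entry (1 : M) s t = (s == t)%:R.
Proof. by []. Qed.

Lemma entry_mul_diag a b s : entry (a * b) s s = entry a s s * entry b s s.
Proof. by rewrite entry_mulE poset_itv_refl fset_set1 big_seq_fset1. Qed.

(** In the layer [j.+1] only the two extreme terms of a product entry survive:
    for [u] strictly between [s] and [t], the interval [[s, u]] is smaller than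
    [[s, t]]. *)
Lemma entry_mul_level j a b s t : unipotent_level j a -> (s < t)%O ->
  (itv_card s t <= j.+1)%N ->
  entry (a * b) s t = entry b s t + entry a s t * entry b t t.
Proof.
move=> aj st cst; have [sle snt] := (ltW st, lt_eqF st).
have ss : entry a s s = 1.
  rewrite aj ?eqxx// itv_card_refl -ltnS; apply: leq_trans cst.
  rewrite -(itv_card_refl s); apply: itv_card_ltl => //; first by rewrite snt.
have sI : s \in fset_set (poset_itv s t) by rewrite in_itv lexx sle.
rewrite entry_mulE (big_fsetD1 _ sI) /= ss mul1r; congr (_ + _).
have tI : t \in (fset_set (poset_itv s t) `\ s)%fset.
  by rewrite !inE in_itv eq_sym snt lexx sle.
rewrite (big_fsetD1 _ tI) /= big1_fset ?addr0// => u.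
rewrite !inE in_itv => /and3P[ut us /andP[su uT]] _.
rewrite aj; first by rewrite eq_sym (negPf us) mul0r.
by rewrite -ltnS; apply: leq_trans cst; exact: itv_card_ltl.
Qed.

(** With [b = 1] this bounds the inverse of [a], and with [a = y * x] and
    [b = x * y] the commutator of [x] and [y]. *)
Lemma unipotent_level_solve j a a' b c :
  a' * a = 1 -> unipotent_level j a -> a * c = b ->
  (forall s t, (itv_card s t <= j.+1)%N -> entry a s t = entry b s t) ->
  unipotent_level j.+1 c.
Proof.
move=> a'a aj acb ab.
have cd s : entry c s s = 1.
  have abs : entry a s s = entry b s s by apply: ab; rewrite itv_card_refl.
  have a's : entry a' s s * entry a s s = 1.
    by rewrite -entry_mul_diag a'a entry1 eqxx.
  by rewrite -[LHS]mul1r -a's -mulrA -entry_mul_diag acb -abs a's.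
move=> s t cst; have [->|snt] := eqVneq s t; first exact: cd.
have [st|st] := boolP (s <= t)%O; last by rewrite entry_eq0.
have lt_st : (s < t)%O by rewrite lt_neqAle snt.
have := entry_mul_level c aj lt_st cst.
by rewrite acb -ab// cd mulr1 -[LHS]add0r => /addIr <-.
Qed.

(** On the diagonal this is commutativity of [P]; off it, the entries of the
    layer [j.+1] add up. *)
Lemma entry_mul_comm j a b s t : unipotent_level j a -> unipotent_level j b ->
  (itv_card s t <= j.+1)%N -> entry (a * b) s t = entry (b * a) s t.
Proof.
move=> aj bj cst; have [->|snt] := eqVneq s t.
  by rewrite !entry_mul_diag mulrC.
have [st|st] := boolP (s <= t)%O; last by rewrite !entry_eq0.
have lt_st : (s < t)%O by rewrite lt_neqAle snt.
have j0 : (0 < j)%N.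
  rewrite -ltnS; apply: leq_trans cst; rewrite -(itv_card_refl s).
  exact: itv_card_ltl.
rewrite (entry_mul_level b aj)// (entry_mul_level a bj)//.
by rewrite !(aj t t, bj t t) ?itv_card_refl// eqxx !mulr1 addrC.
Qed.

Definition unipotent_group j : set GLP := [set x | unipotent_level j (val x)].

Lemma unit_left_inverse (x : GLP) : exists a', a' * val x = 1.
Proof. by have /set_mem[a' [_ ?]] := valP x; exists a'. Qed.

Lemma unipotent_group0 (x : GLP) : unipotent_group 0 x.
Proof.
move=> s t; rewrite leqn0 => /eqP c0; rewrite entry_eq0; last first.
  apply/negP => st; have : s \in fset_set (poset_itv s t).
    by rewrite in_itv lexx st.
  by move/eqP: c0; rewrite cardfs_eq0 => /eqP ->; rewrite inE.
by case: eqP => // st; rewrite st itv_card_refl in c0.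
Qed.

Lemma is_subgroup_unipotent_group j : is_subgroup (unipotent_group j).
Proof.
case: j => [|j].
  by split=> [|x y _ _]; exact: unipotent_group0.
have div (x y z : GLP) : unipotent_group j.+1 x -> unipotent_group j.+1 y ->
    (x * z)%g = y -> unipotent_group j.+1 z.
  move=> xj yj xz; have [a' a'x] := unit_left_inverse x.
  apply: (@unipotent_level_solve j (val x) a' (val y) (val z)) => //.
  - by move=> s t cst; apply: xj; exact: leqW.
  - by rewrite -xz.
  - by move=> s t cst; rewrite (xj _ _ cst) (yj _ _ cst).
have one : unipotent_group j.+1 (1%g : GLP) by [].
have inv x : unipotent_group j.+1 x -> unipotent_group j.+1 (x^-1)%g.
  by move=> xj; apply: (div x 1%g) => //; exact: mulgV.
split=> // x y xj yj; apply: (div (x^-1)%g (y^-1)%g); [exact: inv..|].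
by rewrite mulKg.
Qed.

Lemma unipotent_group_comm j (x y : GLP) :
  unipotent_group j x -> unipotent_group j y -> unipotent_group j.+1 [~ x, y]%g.
Proof.
move=> xj yj; have [a' a'x] := unit_left_inverse (y * x)%g.
have sj := is_subgroup_unipotent_group j.
apply: (@unipotent_level_solve j (val (y * x)%g) a' (val (x * y)%g)) => //.
- exact: (is_subgroupM sj).
- by rewrite [in RHS]commgC.
- by move=> s t cst; exact: entry_mul_comm cst.
Qed.

Lemma unipotent_group_trivial (x : GLP) : unipotent_group n x -> x = 1%g.
Proof.
move=> xn; apply: val_inj; apply: entryP => s t.
by rewrite xn ?itv_card_le.
Qed.

Lemma derived_unipotent_group (G : topGroupType) (U : subgroup G)
    (f : subgrp U -> GLP) k :
  {morph f : x y / (x * y)%g} ->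
  derived k (U : set G) `<=` val @` (f @^-1` (unipotent_group k)).
Proof.
move=> fM.
have f1 : f 1%g = 1%g by apply: (mulgI (f 1%g)); rewrite -fM !mulg1.
have fV x : f x^-1%g = (f x)^-1%g by apply: (mulgI (f x)); rewrite -fM !mulgV.
have sV j : is_subgroup (val @` (f @^-1` (unipotent_group j)) : set G).
  apply: (embedding_subgroup (embedding_val U)).
  have sj := is_subgroup_unipotent_group j.
  split=> [|x y xj yj]; rewrite /preimage /= ?f1 ?fM ?fV; first exact: (is_subgroup1 sj).
  exact: sj.2.
elim: k => [|k IH] /=.
  move=> x Ux; exists (exist _ x (mem_set Ux)) => //=.
  exact: unipotent_group0.
apply: generated_sub; first exact: sV.
move=> _ [_ [_ [/IH[x xk <-] /IH[y yk <-] ->]]]; exists [~ x, y]%g => //=.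
rewrite !commgEl !conjgE !fM !fV -conjgE -commgEl; exact: unipotent_group_comm.
Qed.

End IncidenceGroup.

Theorem corollary3p24 (n : nat) (d : Order.disp_t) (L : porderType d)
    (nL : n_bounded n L)
    (P : topComNzRingType) (profP : profinite P) (scP : @second_countable P)
    (G : topGroupType) (tG : tdlcsc G)
    (U : subgroup G) (oU : open U) (cU : compact U)
    (isoU : topologically_isomorphic
              (subgrp U) (GL (n_bounded_locally_finite nL) P)) :
  elementary G /\ ord_lt (decomposition_rank G) omega.
Proof.
have [f [g [fM fK _ _ _]]] := isoU.
apply: (@elementary_of_solvable_open_subgroup G U n) => // x dx.
have [u un <-] := derived_unipotent_group fM dx.
have fu1 := unipotent_group_trivial un.
have f1 : f 1%g = 1%g by apply: (mulgI (f 1%g)); rewrite -fM !mulg1.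
by rewrite -(fK u) fu1 -f1 fK.
Qed.
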